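(* Let $\chi$ be the cut-off operator defined in the context, and for $\varepsilon>0$ define the scaled cut-off $\chi_\varepsilon(u):=\varepsilon\,\chi(u/\varepsilon)$. Fix $\eta>0$. There exist universal constants $C_0,C_1,C_L>0$ (independent of $\varepsilon$) such that for every $\varepsilon>0$: (i) $\chi_\varepsilon$ is well defined as a map from $H^1_{-\eta}(\mathbb{R},\mathbb{R}^n)$ into $H^1_{-\eta}(\mathbb{R},\mathbb{R}^n)$; (ii) $\chi_\varepsilon\circ\tau_y=\tau_y\circ\chi_\varepsilon$ for all $y\in\mathbb{R}$, where $(\tau_y u)(x)=u(x-y)$; (iii) $\chi_\varepsilon(u)=u$ whenever $u\in H^1_{\mathrm{u}}(\mathbb{R},\mathbb{R}^n)$ and $\|u\|_{H^1_{\mathrm{u}}}<C_0\varepsilon$; (iv) for all $u\in H^1_{-\eta}(\mathbb{R},\mathbb{R}^n)$, $\chi_\varepsilon(u)\in H^1_{\mathrm{u}}(\mathbb{R},\mathbb{R}^n)$ and $\|\chi_\varepsilon(u)\|_{H^1_{\mathrm{u}}}<C_1\varepsilon$; (v) $\chi_\varepsilon:H^1_{-\eta}(\mathbb{R},\mathbb{R}^n)\to H^1_{-\eta}(\mathbb{R},\mathbb{R}^n)$ is globally Lipschitz continuous with Lipschitz constant $C_L$.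
   Context: Let $n\ge 1$. Function spaces. For $\eta>0$, $H^1_{-\eta}(\mathbb{R},\mathbb{R}^n)$ is the exponentially weighted Sobolev space of functions $u\in H^1_{\mathrm{loc}}(\mathbb{R},\mathbb{R}^n)$ with finite norm $\|u\|_{H^1_{-\eta}}^2=\int_{\mathbb{R}} e^{-2\eta|x|}\left(|u(x)|^2+|u'(x)|^2\right)dx$ (equivalently, up to constants, $\sum_{j\in\mathbb{Z}}e^{-2\eta|j|}\|u\|^2_{H^1([j,j+1],\mathbb{R}^n)}$); exponential growth at $\pm\infty$ is allowed. $H^1_{\mathrm{u}}(\mathbb{R},\mathbb{R}^n)$ is the space of functions $u\in H^1_{\mathrm{loc}}(\mathbb{R},\mathbb{R}^n)$ with finite norm $\|u\|_{H^1_{\mathrm{u}}}=\sup_{y\in\mathbb{R}}\|u(\cdot-y)\|_{H^1([0,1],\mathbb{R}^n)}$. One has $H^1_{\mathrm{u}}\subset H^1_{-\eta}$ for every $\eta>0$. Auxiliary functions (fixed once and for all). $\underline{\chi}:\mathbb{R}\to\mathbb{R}$ is a smooth version of the characteristic function of $[-1,1]$, that is, $\underline{\chi}(x)=0$ for $|x|>2$, $\underline{\chi}(x)=1$ for $|x|<1$, and $0\le|\underline{\chi}'(x)|\le 2$. $\theta:\mathbb{R}\to\mathbb{R}$ is a smooth generator of a $\mathbb{Z}$-invariant partition of unity: $\sum_{j\in\mathbb{Z}}\theta(x-j)=1$ for all $x$, $\mathrm{supp}\,\theta\subset(-\tfrac14,\tfrac54)$, $\theta\ge 0$, and $\theta([0,1])\subset[\tfrac12,1]$.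 Cut-off operator. For $u\in H^1_{-\eta}(\mathbb{R},\mathbb{R}^n)$, $$[\chi(u)](x)=\int_{y\in\mathbb{R}}\underline{\chi}\left(\|\theta(\cdot-y)u(\cdot)\|_{H^1(\mathbb{R},\mathbb{R}^n)}\right)\theta(x-y)\,u(x)\,dy.$$ *)

(* Defs.v *)
From HB Require Import structures.
From mathcomp Require Import all_boot all_order all_algebra.
From mathcomp Require Import all_classical all_reals all_analysis.

Set Implicit Arguments.
Unset Strict Implicit.
Unset Printing Implicit Defensive.

Import Order.TTheory GRing.Theory Num.Theory.
Import numFieldTopology.Exports numFieldNormedType.Exports.

Local Open Scope classical_set_scope.
Local Open Scope ring_scope.

(* Elements of the Sobolev spaces are represented by Borel functions
   [R -> 'rV[R]_n]; two functions represent the same element when they are equal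
   almost everywhere for the Lebesgue measure. *)

Definition smooth (R : realType) (f : R -> R) : Prop :=
  forall (k : nat) (x : R), derivable (derive1n k f) x 1.

Definition fsupp (R : realType) (f : R -> R) : set R :=
  closure [set x | f x != 0].

Definition test_function (R : realType) (phi : R -> R) : Prop :=
  smooth phi /\ compact (fsupp phi).

(* The library norm on ['rV_n] is the sup norm; this is the squared Euclidean
   one. *)
Definition sqnorm (R : realType) (n : nat) (v : 'rV[R]_n) : R :=
  \sum_(i < n) v 0 i ^+ 2.

Definition L2loc (R : realType) (n : nat) (u : R -> 'rV[R]_n) : Prop :=
  (forall i : 'I_n, measurable_fun [set: R] (fun x => u x 0 i)) /\
  (forall K : set R, compact K ->
     (\int[lebesgue_measure]_(x in K) (sqnorm (u x))%:E < +oo)%E).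

Definition is_weak_deriv (R : realType) (n : nat) (u v : R -> 'rV[R]_n) : Prop :=
  forall (phi : R -> R) (i : 'I_n), test_function phi ->
    \int[lebesgue_measure]_(x in [set: R]) (u x 0 i * derive1 phi x) =
    - \int[lebesgue_measure]_(x in [set: R]) (v x 0 i * phi x).

Definition H1loc (R : realType) (n : nat) (u : R -> 'rV[R]_n) : Prop :=
  L2loc u /\ exists v, L2loc v /\ is_weak_deriv u v.

(* For [u] in H^1_loc this is a representative of u', unique almost everywhere. *)
Definition weak_deriv (R : realType) (n : nat) (u : R -> 'rV[R]_n) :
    R -> 'rV[R]_n :=
  xget (fun=> 0) [set v | L2loc v /\ is_weak_deriv u v].

(* The H^1 norm on [D] with weight [w]; for [u] in H^1_loc and [D] an interval,
   the weak derivative on [D] is the restriction of the one on the line. *)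
Definition H1norm (R : realType) (n : nat) (w : R -> R) (D : set R)
    (u : R -> 'rV[R]_n) : \bar R :=
  sqrte (\int[lebesgue_measure]_(x in D)
    (w x * (sqnorm (u x) + sqnorm (weak_deriv u x)))%:E)%E.

Definition normH1 (R : realType) (n : nat) (u : R -> 'rV[R]_n) : \bar R :=
  H1norm (fun=> 1) [set: R] u.

Definition normH1w (R : realType) (n : nat) (eta : R) (u : R -> 'rV[R]_n) :
    \bar R :=
  H1norm (fun x => expR (- (2 * eta * `|x|))) [set: R] u.

Definition translate (R : realType) (n : nat) (y : R) (u : R -> 'rV[R]_n) :
    R -> 'rV[R]_n :=
  fun x => u (x - y).

Definition normH1u (R : realType) (n : nat) (u : R -> 'rV[R]_n) : \bar R :=
  ereal_sup (range (fun y : R =>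
    H1norm (fun=> 1) [set x | 0 <= x <= 1] (translate y u))).

Definition H1 (R : realType) (n : nat) : set (R -> 'rV[R]_n) :=
  [set u | H1loc u /\ (normH1 u < +oo)%E].

Definition H1w (R : realType) (n : nat) (eta : R) : set (R -> 'rV[R]_n) :=
  [set u | H1loc u /\ (normH1w eta u < +oo)%E].

Definition H1u (R : realType) (n : nat) : set (R -> 'rV[R]_n) :=
  [set u | H1loc u /\ (normH1u u < +oo)%E].

Definition smooth_indicator (R : realType) (chi0 : R -> R) : Prop :=
  [/\ smooth chi0,
      forall x, `|x| > 2 -> chi0 x = 0,
      forall x, `|x| < 1 -> chi0 x = 1
    & forall x, 0 <= `|derive1 chi0 x| <= 2].

Definition partition_generator (R : realType) (theta : R -> R) : Prop :=
  [/\ smooth theta,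
      forall x : R, (\esum_(j in [set: int]) (theta (x - j%:~R))%:E = 1)%E,
      fsupp theta `<=` [set x | - (1 / 4) < x < 5 / 4],
      forall x, 0 <= theta x
    & forall x : R, 0 <= x <= 1 -> 1 / 2 <= theta x <= 1].

Definition window (R : realType) (n : nat) (theta : R -> R)
    (u : R -> 'rV[R]_n) (y : R) : R -> 'rV[R]_n :=
  fun x => theta (x - y) *: u x.

(* [fine] is harmless here: [cutoff_defined] below records finiteness. *)
Definition cutoff_integrand (R : realType) (n : nat) (chi0 theta : R -> R)
    (u : R -> 'rV[R]_n) (x y : R) : 'rV[R]_n :=
  (chi0 (fine (normH1 (window theta u y))) * theta (x - y)) *: u x.

Definition cutoff (R : realType) (n : nat) (chi0 theta : R -> R)
    (u : R -> 'rV[R]_n) : R -> 'rV[R]_n :=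
  fun x => \row_(i < n)
    \int[lebesgue_measure]_(y in [set: R]) cutoff_integrand chi0 theta u x y 0 i.

(* [fine] and the Lebesgue integral are total, so the meaningfulness of the
   formula for [cutoff] has to be stated separately. *)
Definition cutoff_defined (R : realType) (n : nat) (chi0 theta : R -> R)
    (u : R -> 'rV[R]_n) : Prop :=
  (forall y, H1 (window theta u y)) /\
  (forall x (i : 'I_n), (@lebesgue_measure R).-integrable [set: R]
     (fun y => (cutoff_integrand chi0 theta u x y 0 i)%:E)).

Definition cutoff_eps (R : realType) (n : nat) (chi0 theta : R -> R) (eps : R)
    (u : R -> 'rV[R]_n) : R -> 'rV[R]_n :=
  fun x => eps *: cutoff chi0 theta (fun z => eps^-1 *: u z) x.

(* Main.v *)
(* Write J u = (u, u') for the 1-jet of u, and w_y(u) for the jet of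
   theta(. - y) u.  The jet of the cut-off is the integral over y of S(w_y(u)),
   where S(w) = chi0(|w|) w is the radial truncation of the Hilbert space
   L^2 x L^2.  S is bounded by 10 and 9-Lipschitz, and only the y with
   |x - y| <= 5/4 contribute at x; so the Cauchy-Schwarz inequality in y,
   Tonelli's theorem and the slow variation of the weight exp(-2 eta |x|) turn
   these two properties of S into the uniform bound and the Lipschitz estimate.
   Small functions are fixed since then chi0 = 1 throughout and theta has
   integral 1.  That the integral of the jets is the jet of the integral
   follows from Fubini's theorem against a test function, so the smoothness of
   the multiplier x |-> \int chi0(..) theta(x - y) dy is never needed.  Weak
   derivatives are unique by Lebesgue's differentiation theorem, the rescaled
   theta serving as mollifiers. *)

Require Import Defs.
From HB Require Import structures.
From mathcomp Require Import all_boot all_order all_algebra.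
From mathcomp Require Import all_classical all_reals all_analysis.
From mathcomp Require Import measurable_realfun zify ring lra.

Set Implicit Arguments.
Unset Strict Implicit.
Unset Printing Implicit Defensive.

Import Order.TTheory GRing.Theory Num.Theory.
Import numFieldTopology.Exports numFieldNormedType.Exports.
Local Open Scope classical_set_scope.
Local Open Scope ring_scope.

(** * Invariance of the Lebesgue integral *)

(** The weight [chi0(|w_y(u)|)] depends on [y] but not on [x]. Differentiation in [x] therefore acts
    on the window alone, and a function and its derivative get multiplied by the same scalar; this
    is why the cut-off acts on whole jets, stored below as single vectors of length [n + n]. The
    weak derivative inside the norms is an arbitrary choice of representative. All arguments
    therefore run on explicit pairs [(u, U)], and uniqueness of weak derivatives serves only to
    replace the chosen derivative by [U] in a norm. [S] is Lipschitz for the unweighted L^2 norm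
    only. The exponential weight has to be frozen at the centre of each window, which costs a factor
    [exp (5 / 2 * eta)] on the way in and once more on the way back. The value 5 bounds [chi0],
    which is 1 at the origin, has slope at most 2 and vanishes beyond 2; hence 10 = 5 * 2 and 9 = 5
    + 2 * 2. The remaining constants depend only on [eta] and on a bound [K] for the derivative of
    [theta]. None depends on [eps], since the estimates for [S] are applied to [u / eps]. *)

Section invariance.
Context {R : realType}.
Local Notation mu := (@lebesgue_measure R).

(** Lebesgue measure is determined by its values on half-open intervals, and the preimage of such an
    interval is one of the same length. *)
Lemma lebesgue_measure_shift (a : R) (A : set R) : measurable A ->
  pushforward mu ((fun x => x + a) : _ -> measurableTypeR R) A = mu A.
Proof.
move=> mA.
have ms : measurable_fun [set: R] (fun x : R => x + a) by exact: measurable_funD.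
apply/esym/lebesgue_measure_unique => //= _ [[b c]] _ <-.
rewrite /pushforward.
rewrite (_ : _ @^-1` _ = `]b - a, c - a]%classic); last first.
  by apply/seteqP; split => x /=; rewrite !in_itv/= ltrBlDr lerBrDr.
rewrite !lebesgue_measure_itv/= !lte_fin ltrD2r.
by rewrite -!EFinB opprB addrA subrK.
Qed.

Local Open Scope ereal_scope.

(** Serves translations and reflections alike. For non-negative functions this is integration
    against a pushforward; the general case splits into positive and negative parts, so
    integrability is not at issue. *)
Lemma integral_invariant (phi : R -> R) (f : R -> \bar R) (D : set R) :
  measurable_fun setT phi ->
  (forall A : set R, measurable A ->
     pushforward mu (phi : _ -> measurableTypeR R) A = mu A) ->
  measurable D -> measurable_fun D f ->
  \int[mu]_(x in phi @^-1` D) f (phi x) = \int[mu]_(x in D) f x.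
Proof.
move=> mphi phiP mD mf.
have ge0 (g : R -> \bar R) : measurable_fun D g -> (forall x, 0 <= g x) ->
    \int[mu]_(x in phi @^-1` D) g (phi x) = \int[mu]_(x in D) g x.
  move=> mg g0.
  transitivity (\int[pushforward mu (phi : _ -> measurableTypeR R)]_(x in D) g x).
    by rewrite ge0_integral_pushforward.
  by apply: eq_measure_integral => //= A mA AS; exact: phiP.
rewrite integralE [RHS]integralE -[X in _ = X - _]ge0//; last first.
  exact: measurable_funepos.
rewrite -[X in _ = _ - X]ge0//; last first.
  exact: measurable_funeneg.
by congr (_ - _); apply: eq_integral => x _; rewrite (funepos_comp, funeneg_comp).
Qed.

Lemma integral_shift (a : R) (f : R -> \bar R) (D : set R) :
  measurable D -> measurable_fun D f ->
  \int[mu]_(x in [set x | D (x + a)%R]) f (x + a)%R = \int[mu]_(x in D) f x.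
Proof.
move=> mD mf; apply: (@integral_invariant (fun x => x + a)%R) => //.
  exact: measurable_funD.
by move=> A mA; exact: lebesgue_measure_shift.
Qed.

Lemma lebesgue_measure_reflect (a : R) (A : set R) : measurable A ->
  pushforward mu ((fun x => a - x)%R : _ -> measurableTypeR R) A = mu A.
Proof.
move=> mA.
have ms : measurable_fun [set: R] (fun x : R => a - x)%R by exact: measurable_funB.
apply/esym/lebesgue_measure_unique => //= _ [[b c]] _ <-.
rewrite /pushforward.
rewrite (_ : _ @^-1` _ = `[a - c, a - b[%classic)%R; last first.
  apply/seteqP; split => x /=; rewrite !in_itv/= => /andP[? ?];
  by apply/andP; split; lra.
rewrite !lebesgue_measure_itv/= !lte_fin ltrD2l ltrN2.
by case: ifP => // _; rewrite -!EFinB; congr EFin; lra.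
Qed.

Lemma integral_reflect (a : R) (f : R -> \bar R) : measurable_fun setT f ->
  \int[mu]_x f (a - x)%R = \int[mu]_x f x.
Proof.
move=> mf; apply: (@integral_invariant (fun x => a - x)%R _ setT) => //.
  exact: measurable_funB.
by move=> A mA; exact: lebesgue_measure_reflect.
Qed.

End invariance.

(** * Smooth functions and test functions *)

Section smooth_functions.
Context {R : realType}.
Implicit Types (f g phi : R -> R) (a b r : R).

(** Smoothness of finite order: the closure properties are proved by induction on [k], peeling off
    one derivative at a time. *)
Definition smoothn (k : nat) f : Prop :=
  forall j x, (j < k)%N -> derivable (derive1n j f) x 1.

Lemma smoothP f : smooth f <-> forall k, smoothn k f.
Proof. by split=> [sf k j x _|sf k x]; [exact: sf|exact: (sf k.+1)]. Qed.

Lemma smoothnS k f :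
  smoothn k.+1 f <-> (forall x, derivable f x 1) /\ smoothn k (derive1 f).
Proof.
split=> [sf|[df sf] [|j] x jk].
- split=> [x|j x jk]; first exact: (sf 0).
  by rewrite -derive1Sn; exact: sf.
- exact: df.
- by rewrite derive1Sn; exact: sf.
Qed.

Lemma smoothnW k f : smoothn k.+1 f -> smoothn k f.
Proof. by move=> sf j x jk; apply: sf; exact: ltnW. Qed.

Lemma smoothnD k f g : smoothn k f -> smoothn k g -> smoothn k (f \+ g).
Proof.
elim: k f g => [|k IH] f g; first by move=> _ _ j x; rewrite ltn0.
move=> /smoothnS[df sf] /smoothnS[dg sg]; apply/smoothnS; split=> [x|].
  exact: derivableD.
rewrite (_ : derive1 _ = derive1 f \+ derive1 g); first exact: IH.
by apply/funext => x /=; rewrite !derive1E; exact: deriveD (df x) (dg x).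
Qed.

Lemma derive1_mul f g x : derivable f x 1 -> derivable g x 1 ->
  derive1 (f \* g) x = derive1 f x * g x + f x * derive1 g x.
Proof.
move=> df dg; have h := deriveM df dg.
rewrite -!derive1E in h.
rewrite addrC (mulrC (derive1 f x)).
exact: h.
Qed.

Lemma smoothnM k f g : smoothn k f -> smoothn k g -> smoothn k (f \* g).
Proof.
elim: k f g => [|k IH] f g; first by move=> _ _ j x; rewrite ltn0.
move=> sf sg.
have /smoothnS[df sf'] := sf; have /smoothnS[dg sg'] := sg.
apply/smoothnS; split=> [x|]; first exact: derivableM.
rewrite (_ : derive1 _ = (derive1 f \* g) \+ (f \* derive1 g)).
  exact: smoothnD (IH _ _ sf' (smoothnW sg)) (IH _ _ (smoothnW sf) sg').
by apply/funext => x; exact: derive1_mul.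
Qed.

Lemma is_derive_affine a b (x : R) : is_derive x 1 (fun x => a * x + b) a.
Proof.
apply: is_derive_eq.
by rewrite addr0; exact: mulr1.
Qed.

Lemma derive1_affine f a b x : derivable f (a * x + b) 1 ->
  derivable (fun x => f (a * x + b)) x 1 /\
  derive1 (fun x => f (a * x + b)) x = a * derive1 f (a * x + b).
Proof.
move=> df; pose g x : R := a * x + b.
have da : is_derive (x : R) 1 (g : R -> R) a by exact: is_derive_affine.
have dg : derivable g x 1 by case: da.
have h := @derive1_comp R g f x dg df; rewrite -[fun x => _]/(f \o g); split.
  have /derivable1_diffP dg' := dg; have /derivable1_diffP df' := df.
  by have /derivable1_diffP := differentiable_comp dg' df'.
by rewrite h mulrC [X in X * _]derive1E derive_val.
Qed.

Lemma smoothnZ k a f : smoothn k f -> smoothn k (fun x => a * f x).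
Proof.
elim: k f => [|k IH] f; first by move=> _ j x; rewrite ltn0.
move=> /smoothnS[df sf]; apply/smoothnS; split=> [x|].
  exact: derivableZ.
rewrite (_ : derive1 _ = fun x => a * derive1 f x); first exact: IH.
by apply/funext => x; rewrite derive1Ml.
Qed.

Lemma smoothn_affine k f a b : smoothn k f -> smoothn k (fun x => f (a * x + b)).
Proof.
elim: k f => [|k IH] f; first by move=> _ j x; rewrite ltn0.
move=> /smoothnS[df sf]; apply/smoothnS; split=> [x|].
  by have [] := derive1_affine (df (a * x + b)).
rewrite (_ : derive1 _ = fun x => a * derive1 f (a * x + b)).
  exact/smoothnZ/IH.
by apply/funext => x; have [] := derive1_affine (df (a * x + b)).
Qed.

Lemma smoothM f g : smooth f -> smooth g -> smooth (f \* g).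
Proof. by move=> /smoothP sf /smoothP sg; apply/smoothP => k; exact: smoothnM. Qed.

Lemma smooth_affine f a b : smooth f -> smooth (fun x => f (a * x + b)).
Proof. by move=> /smoothP sf; apply/smoothP => k; exact: smoothn_affine. Qed.

Lemma smooth_derivable f : smooth f -> forall x, derivable f x 1.
Proof. by move=> sf; exact: (sf 0). Qed.

Lemma smooth_derive1 f : smooth f -> smooth (derive1 f).
Proof. by move=> sf k x; rewrite -derive1Sn; exact: sf. Qed.

Lemma smooth_continuous f : smooth f -> continuous f.
Proof.
by move=> sf x; exact/differentiable_continuous/derivable1_diffP/smooth_derivable.
Qed.

Lemma smooth_measurable f : smooth f -> measurable_fun setT f.
Proof. by move=> sf; apply: continuous_measurable_fun; exact: smooth_continuous. Qed.

Lemma vanish_fsupp f r : (forall x, r < `|x| -> f x = 0) ->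
  fsupp f `<=` `[- r, r].
Proof.
move=> fr; have /closure_id -> : closed `[- r, r] by exact: itv_closed.
apply: closureS => x /= fx0; rewrite in_itv/= -ler_norml leNgt.
by apply/negP => /fr; apply/eqP.
Qed.

(** Replaces the compact closed support by a radius, a form in which stability under derivatives,
    products and affine substitutions is immediate. *)
Lemma test_functionP f :
  test_function f <-> smooth f /\ exists r, forall x, r < `|x| -> f x = 0.
Proof.
split=> [[sf cf]|[sf [r fr]]]; split=> //.
  have [M [_ HM]] := compact_bounded cf.
  exists (M + 1) => x xM; apply/eqP; apply: contraTT xM => fx0.
  rewrite -leNgt; apply: (HM (M + 1)); first by rewrite ltrDl.
  exact: subset_closure.
apply: (@subclosed_compact _ _ `[- r, r]).
- exact: closed_closure.
- exact: segment_compact.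
- exact: vanish_fsupp.
Qed.

Lemma derive1_vanish f r : (forall x, r < `|x| -> f x = 0) ->
  forall x, r < `|x| -> derive1 f x = 0.
Proof.
move=> fr x rx; rewrite derive1E (@near_eq_derive _ _ _ f (cst 0)) ?derive_cst//.
have : \forall y \near x, r < `|y|.
  exact: (cvgr_gt (`|x| : R) (@norm_continuous _ R^o x)).
by apply: filterS => y /fr.
Qed.

(* A single [M] bounds both the values and the support. *)
Definition bounded_support f : Prop := measurable_fun setT f /\
  exists M : R, [/\ 0 < M, forall x, `|f x| <= M & forall x, M < `|x| -> f x = 0].

Lemma test_function_bounded f : test_function f -> bounded_support f.
Proof.
move=> /test_functionP[sf [r fr]]; split; first exact: smooth_measurable.
have cK : compact `[- (`|r| + 1), `|r| + 1] by exact: segment_compact.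
have [|M [_ HM]] := compact_bounded (@continuous_compact _ _ f _ _ cK).
  exact/continuous_subspaceT/smooth_continuous.
have := ler_norm M; have := ler_norm r; have := normr_ge0 M; have := normr_ge0 r.
move=> r0 M0 rr MM; exists (`|M| + `|r| + 2); split.
- lra.
- move=> x; have [xr|xr] := leP `|x| (`|r| + 1).
    apply: (HM (`|M| + `|r| + 2)); first lra.
    by exists x => //=; rewrite in_itv/= -ler_norml.
  by rewrite fr ?normr0; lra.
- by move=> x xr; apply: fr; lra.
Qed.

Lemma test_function_derive1 f : test_function f -> test_function (derive1 f).
Proof.
move=> /test_functionP[sf [r fr]]; apply/test_functionP; split.
  exact: smooth_derive1.
by exists r; exact: derive1_vanish.
Qed.

Lemma test_function_affine f a b : a != 0 -> test_function f ->
  test_function (fun x => f (a * x + b)).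
Proof.
move=> a0 /test_functionP[sf [r fr]]; apply/test_functionP; split.
  exact: smooth_affine.
exists ((`|r| + `|b|) / `|a|) => x; rewrite ltr_pdivrMr ?normr_gt0// => h.
apply: fr; have := ler_normB (a * x + b) b; rewrite addrK normrM.
have := ler_norm r; lra.
Qed.

Lemma test_functionM f g : smooth f -> test_function g -> test_function (f \* g).
Proof.
move=> sf /test_functionP[sg [r gr]]; apply/test_functionP; split.
  exact: smoothM.
by exists r => x /gr /= ->; rewrite mulr0.
Qed.

End smooth_functions.

(** * Locally square-integrable functions *)

Section vector_functions.
Context {R : realType}.
Local Notation mu := (@lebesgue_measure R).

Definition measurable_vec d (T : measurableType d) n (u : T -> 'rV[R]_n) : Prop :=
  forall i, measurable_fun setT (fun x => u x 0 i).

Lemma sqnorm_ge0 n (v : 'rV[R]_n) : 0 <= sqnorm v.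
Proof. by apply: sumr_ge0 => i _; exact: sqr_ge0. Qed.

Lemma sqnorm0 n : sqnorm (0 : 'rV[R]_n) = 0.
Proof. by apply: big1 => i _; rewrite mxE expr0n. Qed.

Lemma sqnormZ n a (v : 'rV[R]_n) : sqnorm (a *: v) = a ^+ 2 * sqnorm v.
Proof. by rewrite mulr_sumr; apply: eq_bigr => i _; rewrite mxE exprMn. Qed.

Lemma sqnormN n (v : 'rV[R]_n) : sqnorm (- v) = sqnorm v.
Proof. by rewrite -scaleN1r sqnormZ sqrrN expr1n mul1r. Qed.

Lemma sqnorm_row_mx n m (u : 'rV[R]_n) (v : 'rV[R]_m) :
  sqnorm (row_mx u v) = sqnorm u + sqnorm v.
Proof.
rewrite /sqnorm big_split_ord/=; congr (_ + _); apply: eq_bigr => i _.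
  by rewrite row_mxEl.
by rewrite row_mxEr.
Qed.

(** Coordinatewise the difference of the two sides is the square [t^-1 * (t * a - b) ^+ 2]. The
    parameter [t] is kept free in order to be optimised in [l2norm_triangle]. *)
Lemma sqnormD_le n t (u v : 'rV[R]_n) : 0 < t ->
  sqnorm (u + v) <= (1 + t) * sqnorm u + (1 + t^-1) * sqnorm v.
Proof.
move=> t0; rewrite !mulr_sumr -big_split; apply: ler_sum => i _ /=; rewrite mxE.
rewrite -subr_ge0; set a := u 0 i; set b := v 0 i.
rewrite (_ : _ - _ = t^-1 * (t * a - b) ^+ 2); last by field; rewrite gt_eqF.
by rewrite mulr_ge0 ?sqr_ge0// invr_ge0 ltW.
Qed.

Lemma sqnormD_le2 n (u v : 'rV[R]_n) :
  sqnorm (u + v) <= 2 * (sqnorm u + sqnorm v).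
Proof. by have := sqnormD_le u v (@ltr01 R); rewrite invr1 -mulrDr. Qed.

Lemma sqnormB_le2 n (u v : 'rV[R]_n) :
  sqnorm (u - v) <= 2 * (sqnorm u + sqnorm v).
Proof. by rewrite -(sqnormN v) sqnormD_le2. Qed.

Lemma sqr_le_sqnorm n (v : 'rV[R]_n) i : v 0 i ^+ 2 <= sqnorm v.
Proof.
rewrite /sqnorm (bigD1 i)//= lerDl; apply: sumr_ge0 => j _; exact: sqr_ge0.
Qed.

Lemma measurable_sqnorm d (T : measurableType d) n (u : T -> 'rV[R]_n) :
  measurable_vec u -> measurable_fun setT (fun x => sqnorm (u x)).
Proof.
by move=> mu'; apply: measurable_sum => i; exact: measurable_funX.
Qed.

Lemma measurable_vecD d (T : measurableType d) n (u v : T -> 'rV[R]_n) :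
  measurable_vec u -> measurable_vec v -> measurable_vec (fun x => u x + v x).
Proof.
move=> hu hv i; under eq_fun do rewrite mxE.
exact: measurable_funD.
Qed.

Lemma measurable_vecZ d (T : measurableType d) n (a : T -> R) (u : T -> 'rV[R]_n) :
  measurable_fun setT a -> measurable_vec u -> measurable_vec (fun x => a x *: u x).
Proof.
move=> ma hu i; under eq_fun do rewrite mxE.
exact: measurable_funM.
Qed.

Lemma measurable_vecN d (T : measurableType d) n (u : T -> 'rV[R]_n) :
  measurable_vec u -> measurable_vec (fun x => - u x).
Proof.
move=> hu i; under eq_fun do rewrite mxE.
exact: measurable_funN.
Qed.

Lemma measurable_vecB d (T : measurableType d) n (u v : T -> 'rV[R]_n) :
  measurable_vec u -> measurable_vec v -> measurable_vec (fun x => u x - v x).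
Proof. by move=> hu hv; exact: measurable_vecD hu (measurable_vecN hv). Qed.

Lemma measurable_vec_row_mx d (T : measurableType d) n m
    (u : T -> 'rV[R]_n) (v : T -> 'rV[R]_m) :
  measurable_vec u -> measurable_vec v -> measurable_vec (fun x => row_mx (u x) (v x)).
Proof.
move=> hu hv i; under eq_fun do rewrite mxE.
by case: (fintype.split i) => j; [exact: hu|exact: hv].
Qed.

Lemma measurable_vec_comp d (T : measurableType d) d' (T' : measurableType d') n
    (u : T -> 'rV[R]_n) (f : T' -> T) :
  measurable_vec u -> measurable_fun setT f -> measurable_vec (fun x => u (f x)).
Proof. by move=> hu mf i; exact: measurableT_comp (hu i) mf. Qed.

(** The three dimensions are independent so that a jet with [n + n] entries can be dominated by its
    two halves. The sign of [C] is left open, hence the absolute value in the proof. *)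
Lemma L2loc_le n m p (C : R) (u : R -> 'rV[R]_n) (v : R -> 'rV[R]_m) (w : R -> 'rV[R]_p) :
  measurable_vec u -> L2loc v -> L2loc w ->
  (forall x, sqnorm (u x) <= C * (sqnorm (v x) + sqnorm (w x))) -> L2loc u.
Proof.
move=> hu [hv fv] [hw fw] uvw; split=> // K cK; have mK := compact_measurable cK.
have mS k (z : R -> 'rV[R]_k) : measurable_vec z ->
    measurable_fun K (fun x => (sqnorm (z x))%:E).
  by move=> hz; apply/measurable_EFinP/measurable_funTS; exact: measurable_sqnorm.
apply: (@le_lt_trans _ _ (\int[mu]_(x in K)
    (`|C|%:E * ((sqnorm (v x))%:E + (sqnorm (w x))%:E)))%E).
  apply: ge0_le_integral => //.
  - by move=> x _; rewrite lee_fin sqnorm_ge0.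
  - exact: mS.
  - apply: emeasurable_funM => //; apply: emeasurable_funD; exact: mS.
  - move=> x _; rewrite lee_fin (le_trans (uvw x))//.
    by rewrite ler_wpM2r ?ler_norm// addr_ge0// sqnorm_ge0.
rewrite ge0_integralZl//; last 2 first.
- apply: emeasurable_funD; exact: mS.
- by move=> x _; rewrite adde_ge0// lee_fin sqnorm_ge0.
rewrite ge0_integralD//; last 4 first.
- by move=> x _; rewrite lee_fin sqnorm_ge0.
- exact: mS.
- by move=> x _; rewrite lee_fin sqnorm_ge0.
- exact: mS.
by rewrite lte_mul_pinfty//; apply: lte_add_pinfty; [exact: fv|exact: fw].
Qed.

Lemma L2loc0 n : L2loc (fun _ : R => 0 : 'rV[R]_n).
Proof.
split=> [i|K cK]; first exact: measurable_cst.
by under eq_integral do rewrite sqnorm0; rewrite integral0.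
Qed.

Lemma L2loc_leZ n m (C : R) (u : R -> 'rV[R]_n) (v : R -> 'rV[R]_m) :
  measurable_vec u -> L2loc v ->
  (forall x, sqnorm (u x) <= C * sqnorm (v x)) -> L2loc u.
Proof.
(* The second dominating function is the zero function with values in dimension 0. *)
move=> hu lv uv; apply: (L2loc_le hu lv (L2loc0 0)) => x.
by rewrite sqnorm0 addr0.
Qed.

Lemma L2locB n (u v : R -> 'rV[R]_n) : L2loc u -> L2loc v ->
  L2loc (fun x => u x - v x).
Proof.
move=> lu lv; apply: (L2loc_le _ lu lv) => x; last exact: sqnormB_le2.
by case: lu lv => hu _ [hv _]; exact: measurable_vecB.
Qed.

Lemma L2loc_bounded n (a : R -> R) M (u : R -> 'rV[R]_n) :
  measurable_fun setT a -> (forall x, `|a x| <= M) -> L2loc u ->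
  L2loc (fun x => a x *: u x).
Proof.
move=> ma aM lu; apply: (L2loc_leZ _ lu (C := M ^+ 2)) => [|x].
  by case: lu => hu _; exact: measurable_vecZ.
rewrite sqnormZ ler_wpM2r ?sqnorm_ge0// -ler_sqrt ?sqr_ge0//.
by rewrite !sqrtr_sqr (le_trans (aM x))// ler_norm.
Qed.

(** Compact sets have finite measure, and [|s| <= 1 + s ^+ 2] for every real [s]. *)
Lemma L2loc_integrable n (u : R -> 'rV[R]_n) i K : L2loc u -> compact K ->
  mu.-integrable K (fun x => (u x 0 i)%:E).
Proof.
move=> [hu fu] cK; have mK := compact_measurable cK.
have mui : measurable_fun K (fun x => u x 0 i) by apply: measurable_funTS; exact: hu.
have mS : measurable_fun K (fun x => (sqnorm (u x))%:E).
  by apply/measurable_EFinP/measurable_funTS; exact: measurable_sqnorm.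
apply/integrableP; split; first exact/measurable_EFinP.
apply: (@le_lt_trans _ _ (\int[mu]_(x in K) (1 + (sqnorm (u x))%:E))%E).
  apply: ge0_le_integral => //.
  - by apply: measurableT_comp => //; exact/measurable_EFinP.
  - exact: emeasurable_funD.
  - move=> x _; rewrite /= lee_fin.
    have := sqr_le_sqnorm (u x) i; rewrite -[u x 0 i ^+ 2]real_normK ?num_real//.
    have := sqr_ge0 (`|u x 0 i| - 1); set a := `|_|; nra.
rewrite ge0_integralD//; last by move=> x _; rewrite lee_fin sqnorm_ge0.
rewrite integral_cst// mul1e; apply: lte_add_pinfty; last exact: fu.
exact: compact_finite_measure.
Qed.

(** Makes every pairing with a test function legitimate: the product is dominated by [M] times the
    restriction of the coordinate of [u] to [[- M, M]]. *)
Lemma L2loc_mul_integrable n (u : R -> 'rV[R]_n) i f : L2loc u -> bounded_support f ->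
  mu.-integrable setT (fun x => (u x 0 i * f x)%:E).
Proof.
move=> lu [mf [M [M0 fM f0]]].
have mK : measurable `[- M, M]%classic by exact: measurable_itv.
have h : mu.-integrable setT
    ((fun x => (u x 0 i)%:E) \_ [set` `[(- M)%R, M]])%E.
  by rewrite -integrable_mkcond//; apply: L2loc_integrable => //; exact: segment_compact.
apply: le_integrable (integrableZl measurableT M h) => //.
  by apply/measurable_EFinP; apply: measurable_funM => //; case: lu => hu _; exact: hu.
move=> x _; rewrite patchE; case: ifPn => [_|].
  by rewrite -EFinM/= lee_fin !normrM mulrC ler_pM// (le_trans (fM x))// ler_norm.
move=> xM; rewrite f0 ?mulr0 ?abse0 ?abse_ge0//; move: xM.
by rewrite notin_setE/= in_itv/= -ler_norml ltNge => /negP.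
Qed.

End vector_functions.

(** * Uniqueness of weak derivatives *)

Section almost_everywhere_lebesgue.
Context {R : realType}.
Local Notation mu := (@lebesgue_measure R).

Lemma ae_sub (P Q : R -> Prop) : (forall x, P x -> Q x) ->
  {ae mu, forall x, P x} -> {ae mu, forall x, Q x}.
Proof. by move=> PQ; apply: filterS => //; exact: (ae_filter_ringOfSetsType mu). Qed.

Lemma ae_forall (I : finType) (P : I -> R -> Prop) :
  (forall i, {ae mu, forall x, P i x}) -> {ae mu, forall x i, P i x}.
Proof. by move=> P0; apply: filter_forall => //; exact: (ae_filter_ringOfSetsType mu). Qed.

End almost_everywhere_lebesgue.

Section weak_derivative_uniqueness.
Context {R : realType}.
Local Notation mu := (@lebesgue_measure R).
Variable bump : R -> R.
Hypothesis bump_test : test_function bump.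
Hypothesis bump01 : forall x, 0 <= bump x <= 1.
Hypothesis bump_supp : forall x, 2 <= `|x| -> bump x = 0.
Hypothesis bump_ge : forall x, 0 <= x <= 1 -> 1 / 2 <= bump x.

Lemma bounded_support_integrable (f : R -> R) : bounded_support f ->
  mu.-integrable setT (EFin \o f).
Proof.
(* [f] is its own product with the constant 1, which is locally square-integrable. *)
move=> bf; have lu : L2loc (fun _ : R => const_mx 1 : 'rV[R]_1).
  split=> [i|K cK]; first exact: measurable_cst.
  rewrite integral_cst; last exact: compact_measurable.
  by rewrite lte_mul_pinfty ?lee_fin ?sqnorm_ge0//; exact: compact_finite_measure.
have := L2loc_mul_integrable ord0 lu bf.
by under eq_fun do rewrite mxE mul1r.
Qed.

(* The bump rescaled to width [r] at [z] has mass at least [r / 4], while its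
   integral against [f z - f] is at most [2 * r] times the mean oscillation of
   [f] on the ball of radius [r]. *)
Lemma vanishes_at_lebesgue_pt (f : R -> R) z : locally_integrable setT f ->
  (forall phi, bounded_support phi -> mu.-integrable setT (fun x => (f x * phi x)%:E)) ->
  (forall phi, test_function phi -> \int[mu]_x (f x * phi x) = 0) ->
  lebesgue_pt f z -> f z = 0.
Proof.
move=> lf fi f0 fz; apply: contrapT => /eqP fz0.
have e0 : 0 < `|f z| by rewrite normr_gt0.
(* A ball of radius [r] has length [2 * r], so mean oscillation below [e] bounds the integral by
   [r / 8 * |f z|], half of what the mass [r / 4] of the bump would force. *)
pose e := `|f z| / 16.
have e160 : 0 < e by rewrite divr_gt0.
have [r r0 hr] : exists2 r : R, 0 < r & (davg f z r < e%:E)%E.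
  near (0:R)^'+ => r; exists r; first by near: r; exact: nbhs_right_gt.
  near: r; have h := fz (fun y => (y < e%:E)%E); apply: h.
  by apply: open_ereal_lt'; rewrite lte_fin.
(* The bump vanishes beyond 2 and is at least [1 / 2] on [[0, 1]]; with this factor [phi] vanishes
   off the ball of radius [r] and is at least [1 / 2] on [[z, z + r / 2]]. *)
pose k := 2 / r; have k0 : 0 < k by rewrite divr_gt0.
pose phi x := bump (k * x + - (k * z)).
have tphi : test_function phi by apply: test_function_affine => //; rewrite gt_eqF.
have bphi := test_function_bounded tphi.
have phi01 x : 0 <= phi x <= 1 by exact: bump01.
have iphi := bounded_support_integrable bphi.
have ifphi := fi _ bphi.
have mf : measurable_fun setT f by case: lf.
have mphi : measurable_fun setT phi by case: bphi.
have icz : mu.-integrable setT (fun x => (f z * phi x)%:E).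
  by under eq_fun do rewrite EFinM; exact: integrableZl.
have ic : mu.-integrable setT (fun x => ((f z - f x) * phi x)%:E).
  under eq_fun do rewrite mulrBl EFinB.
  exact: integrableB.
have eqI : \int[mu]_x ((f z - f x) * phi x) = f z * \int[mu]_x phi x.
  under eq_Rintegral do rewrite mulrBl.
  by rewrite RintegralB// f0// subr0 RintegralZl.
have hI : r / 4 <= \int[mu]_x phi x.
  rewrite -lee_fin /Rintegral fineK; last exact: integrable_fin_num.
  have mI : measurable `[z, z + r / 2]%classic by exact: measurable_itv.
  apply: (@le_trans _ _ (\int[mu]_(x in `[z, (z + r / 2)%R]) (phi x)%:E)%E).
    apply: (@le_trans _ _ (\int[mu]_(x in `[z, (z + r / 2)%R]) (1/2)%:E)%E).
      rewrite integral_cst//= lebesgue_measure_itv/= lte_fin ltrDl divr_gt0//.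
      by rewrite -EFinD -EFinM lee_fin; lra.
    apply: ge0_le_integral => //.
    - by apply/measurable_EFinP; exact: measurable_funTS.
    - move=> x /=; rewrite in_itv/= => /andP[zx xz]; rewrite lee_fin.
      apply: bump_ge; rewrite -mulrBr /k mulrAC; apply/andP; split.
        by apply: divr_ge0; lra.
      by rewrite ler_pdivrMr//; lra.
  apply: ge0_subset_integral => //; first exact/measurable_EFinP.
  by move=> x _; rewrite lee_fin; have /andP[] := phi01 x.
have hb : \int[mu]_x `|(f z - f x) * phi x| <= r / 8 * `|f z|.
  rewrite -lee_fin /Rintegral fineK; last first.
    exact/integrable_fin_num/integrable_norm.
  have mB : measurable (ball z r) by exact: measurable_ball.
  apply: (@le_trans _ _ (\int[mu]_(x in ball z r) `|f x - f z|%:E)%E).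
    rewrite [leRHS]integral_mkcond; apply: ge0_le_integral => //.
    - by apply/measurable_EFinP; apply: measurableT_comp => //;
        apply: measurable_funM => //; exact: measurable_funB.
    - apply: (measurable_restrictT _ _).1 => //; apply: measurable_funTS.
      by apply/measurable_EFinP; apply: measurableT_comp => //; exact: measurable_funB.
    - move=> x _; rewrite patchE; case: ifPn => [_|].
        rewrite lee_fin normrM distrC ler_piMr//.
        by have /andP[p0 p1] := phi01 x; rewrite ger0_norm.
      rewrite notin_setE/= -ball_normE/= => /negP; rewrite -leNgt => rzx.
      rewrite /phi bump_supp ?mulr0 ?normr0// -mulrBr normrM gtr0_norm//.
      have -> : 2 = k * r by rewrite /k divfK// gt_eqF.
      by rewrite ler_pM2l// distrC.
  move: hr; rewrite /davg /iavg (lebesgue_measure_ball z (ltW r0)).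
  rewrite inver mulrn_eq0/= (gt_eqF r0) muleC.
  rewrite lte_pdivrMr ?mulrn_wgt0// => /ltW/le_trans; apply.
  rewrite -EFinM lee_fin (_ : e * _ = r / 8 * `|f z|)//.
  by rewrite /e -mulr_natr; field.
have : `|f z * \int[mu]_x phi x| <= r / 8 * `|f z|.
  by rewrite -eqI; exact: le_trans (le_normr_Rintegral measurableT ic) hb.
have I0 : 0 < \int[mu]_x phi x by apply: lt_le_trans hI; rewrite divr_gt0.
rewrite normrM (gtr0_norm I0) [X in _ <= X]mulrC ler_pM2l// => /(le_trans hI).
lra.
Unshelve. all: by end_near. Qed.

Lemma L2loc_locally_integrable n (u : R -> 'rV[R]_n) i : L2loc u ->
  locally_integrable setT (fun x => u x 0 i).
Proof.
move=> lu; split; [by case: lu|exact: openT|move=> K _ cK].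
by have /integrableP[_] := L2loc_integrable i lu cK.
Qed.

Lemma weak_deriv_unique n (u v w : R -> 'rV[R]_n) :
  L2loc v -> L2loc w -> is_weak_deriv u v -> is_weak_deriv u w ->
  {ae mu, forall x, v x = w x}.
Proof.
move=> lv lw uv uw; pose d x := v x - w x.
have ld : L2loc d by exact: L2locB.
have d0 i : {ae mu, forall x, d x 0 i = 0}.
  apply: ae_sub (lebesgue_differentiation (L2loc_locally_integrable i ld)) => x.
  apply: vanishes_at_lebesgue_pt; first exact: L2loc_locally_integrable.
    by move=> phi bphi; exact: L2loc_mul_integrable.
  move=> phi tphi; have bphi := test_function_bounded tphi.
  rewrite (_ : (fun x => _) = (fun x => v x 0 i * phi x - w x 0 i * phi x)); last first.
    by apply/funext => y; rewrite !mxE mulrBl.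
  rewrite RintegralB//; [|exact: L2loc_mul_integrable..].
  have := uv phi i tphi; rewrite uw// => /oppr_inj ->; exact: subrr.
have : {ae mu, forall x, forall i, d x 0 i = 0}.
  exact: ae_forall.
by apply: ae_sub => x dx; apply/rowP => i; move: (dx i); rewrite !mxE => /subr0_eq.
Qed.

End weak_derivative_uniqueness.

(** * Weak 1-jets *)

Section jets.
Context {R : realType}.
Local Notation mu := (@lebesgue_measure R).
Variable theta : R -> R.
Hypothesis htheta : partition_generator theta.

Lemma theta_ge0 x : 0 <= theta x.
Proof. by case: htheta. Qed.

Lemma theta_supp x : theta x != 0 -> - (1 / 4) < x < 5 / 4.
Proof. by move=> tx; case: htheta => _ _ + _ _; apply; exact: subset_closure. Qed.

(** The support lies in [(- 1 / 4, 5 / 4)]; the cruder symmetric radius lets all later locality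
    conditions read [|x - y| <= 5 / 4]. *)
Lemma theta_far x : 5 / 4 <= `|x| -> theta x = 0.
Proof.
move=> x54; apply/eqP; apply: contraLR x54 => /theta_supp; rewrite -ltNge ltr_norml.
by move=> /andP[? ?]; apply/andP; split; lra.
Qed.

Lemma theta_test : test_function theta.
Proof.
apply/test_functionP; split; first by case: htheta.
by exists (5 / 4) => x /ltW; exact: theta_far.
Qed.

(** [partition_generator] states an upper bound on [[0, 1]] only; elsewhere [theta x] is the term
    [j = 0] of a sum of non-negative terms equal to 1. *)
Lemma theta_le1 x : theta x <= 1.
Proof.
case: htheta => _ /(_ x) sum1 _ _ _; rewrite -lee_fin -sum1; apply: esum_ge.
exists [set 0%Z]; first by split => //; exact: finite_set1.
by rewrite fsbig_set1 subr0.
Qed.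

Lemma theta01 x : 0 <= theta x <= 1.
Proof. by rewrite theta_ge0 theta_le1. Qed.

(** Carries the weak derivative as an explicit datum, so that it can be computed with, unlike the
    representative picked by [weak_deriv]. *)
Definition jet n (u V : R -> 'rV[R]_n) : Prop :=
  [/\ L2loc u, L2loc V & is_weak_deriv u V].

Lemma jet_unique n (u V W : R -> 'rV[R]_n) : jet u V -> jet u W ->
  {ae mu, forall x, V x = W x}.
Proof.
move=> [_ lV uV] [_ lW uW]; apply: (weak_deriv_unique theta_test theta01) lV lW uV uW.
- by move=> x x2; apply: theta_far; apply: le_trans x2; lra.
- by move=> x x01; case: htheta => _ _ _ _ /(_ x x01) /andP[].
Qed.

Lemma H1loc_jet n (u : R -> 'rV[R]_n) : H1loc u -> jet u (weak_deriv u).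
Proof.
move=> [lu ex]; rewrite /weak_deriv.
by have [] := @xgetPex _ (fun=> 0) [set v | L2loc v /\ is_weak_deriv u v] ex.
Qed.

Lemma jet_H1loc n (u V : R -> 'rV[R]_n) : jet u V -> H1loc u.
Proof. by move=> [lu lV uV]; split=> //; exists V. Qed.

(** The bridge from the norms of the statement to explicit jets: two weak derivatives agree almost
    everywhere and so give the same integral. *)
Lemma H1norm_jet n (u V : R -> 'rV[R]_n) (w : R -> R) (D : set R) : jet u V ->
  measurable D -> measurable_fun setT w ->
  H1norm w D u =
  sqrte (\int[mu]_(x in D) (w x * (sqnorm (u x) + sqnorm (V x)))%:E)%E.
Proof.
move=> uV mD mw; congr sqrte; have uW := H1loc_jet (jet_H1loc uV).
have mI (Z : R -> 'rV[R]_n) : jet u Z ->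
    measurable_fun D (fun x => (w x * (sqnorm (u x) + sqnorm (Z x)))%:E).
  move=> [[mu' _] [mZ _] _]; apply/measurable_EFinP/measurable_funTS.
  by apply: measurable_funM => //; apply: measurable_funD; exact: measurable_sqnorm.
apply: ae_eq_integral => //; [exact: mI|exact: mI|].
by apply: ae_sub (jet_unique uW uV) => x + _ => ->.
Qed.

Lemma ae_eq_Rintegral (f g : R -> R) : measurable_fun setT f -> measurable_fun setT g ->
  {ae mu, forall x, f x = g x} -> \int[mu]_x f x = \int[mu]_x g x.
Proof.
move=> mf mg fg; congr fine; apply: ae_eq_integral => //; [exact/measurable_EFinP..|].
by apply: ae_sub fg => x + _ => ->.
Qed.

(** [L2loc v] is asked for because Borel measurability does not pass to an almost everywhere equal
    function. *)
Lemma jet_ae n (u v V : R -> 'rV[R]_n) : jet u V -> L2loc v ->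
  {ae mu, forall x, u x = v x} -> jet v V.
Proof.
move=> [lu lV uV] lv uv; split=> // phi i tphi; rewrite -uV//.
have [mphi _] := test_function_bounded (test_function_derive1 tphi).
apply: ae_eq_Rintegral; last by apply: ae_sub uv => x ->.
- by case: lv => mv _; exact: measurable_funM.
- by case: lu => mu' _; exact: measurable_funM.
Qed.

Lemma jetB n (u v U V : R -> 'rV[R]_n) : jet u U -> jet v V ->
  jet (fun x => u x - v x) (fun x => U x - V x).
Proof.
move=> [lu lU uU] [lv lV vV]; split; [exact: L2locB..|move=> phi i tphi].
have dphi := test_function_bounded (test_function_derive1 tphi).
have bphi := test_function_bounded tphi.
under eq_Rintegral do rewrite !mxE mulrBl.
under [in RHS]eq_Rintegral do rewrite !mxE mulrBl.
rewrite !RintegralB//; [|exact: L2loc_mul_integrable..].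
by rewrite uU// vV// opprB opprK addrC.
Qed.

Lemma jetZ n (a : R) (u U : R -> 'rV[R]_n) : jet u U ->
  jet (fun x => a *: u x) (fun x => a *: U x).
Proof.
move=> [lu lU uU]; split; [exact: (L2loc_bounded (M := `|a|))..|move=> phi i tphi].
have dphi := test_function_bounded (test_function_derive1 tphi).
have bphi := test_function_bounded tphi.
under eq_Rintegral do rewrite !mxE -mulrA.
under [in RHS]eq_Rintegral do rewrite !mxE -mulrA.
rewrite !RintegralZl//; [|exact: L2loc_mul_integrable..].
by rewrite uU// mulrN.
Qed.

Lemma jet0 n : jet (fun _ : R => 0 : 'rV[R]_n) (fun _ => 0).
Proof.
split; [exact: L2loc0..|move=> phi i tphi].
under eq_Rintegral do rewrite mxE mul0r.
under [in RHS]eq_Rintegral do rewrite mxE mul0r.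
by rewrite /Rintegral integral0 oppr0.
Qed.

Lemma L2loc_shift n a (u : R -> 'rV[R]_n) : L2loc u -> L2loc (fun x => u (x + a)).
Proof.
have ms : measurable_fun [set: R] (fun x : R => x + a) by exact: measurable_funD.
move=> [mu' fu]; split=> [i|K cK]; first exact: measurableT_comp (mu' i) ms.
pose L := [set x | K (x - a)].
have cL : compact L.
  rewrite (_ : L = [set x + a | x in K]).
    apply: continuous_compact => //; apply: continuous_subspaceT => x.
    by apply: cvgD => //; exact: cvg_cst.
  apply/seteqP; split=> x /=; last by move=> [y Ky <-]; rewrite /L/= addrK.
  by move=> Lx; exists (x - a) => //; rewrite subrK.
apply: le_lt_trans (fu _ cL).
rewrite -(@integral_shift _ a _ L)//; last 2 first.
- exact: compact_measurable.
- by apply/measurable_EFinP/measurable_funTS; exact: measurable_sqnorm.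
by rewrite (_ : [set x | L (x + a)] = K)//; apply/funext => x; rewrite /L/= addrK.
Qed.

Lemma Rintegral_shift (f : R -> R) a : measurable_fun setT f ->
  \int[mu]_x f (x + a) = \int[mu]_x f x.
Proof.
move=> mf; rewrite /Rintegral -(@integral_shift _ a (EFin \o f) setT)//.
exact/measurable_EFinP.
Qed.

(** The translation is moved onto the test function by a change of variables in both integrals. *)
Lemma jet_shift n a (u U : R -> 'rV[R]_n) : jet u U ->
  jet (fun x => u (x + a)) (fun x => U (x + a)).
Proof.
move=> [lu lU uU]; split; [exact: L2loc_shift..|move=> phi i tphi].
pose psi (x : R) := phi (1 * x + - a).
have tpsi : test_function psi by apply: test_function_affine => //; exact: oner_neq0.
have [mphi _] := test_function_bounded tphi.
have [mphi' _] := test_function_bounded (test_function_derive1 tphi).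
have dpsi x : derive1 psi x = derive1 phi (x - a).
  have /test_functionP[sphi _] := tphi.
  have [_] := derive1_affine (@smooth_derivable _ _ sphi (1 * x + - a)).
  by rewrite /psi => ->; rewrite !mul1r.
have [mpsi _] := test_function_bounded tpsi.
have [mpsi' _] := test_function_bounded (test_function_derive1 tpsi).
transitivity (\int[mu]_x (u x 0 i * derive1 psi x)).
  rewrite -[RHS](Rintegral_shift a); last by case: lu => mu' _; exact: measurable_funM.
  by apply: eq_Rintegral => x _; rewrite dpsi addrK.
rewrite uU//; congr (- _).
rewrite -[LHS](Rintegral_shift a); last by case: lU => mU _; exact: measurable_funM.
by apply: eq_Rintegral => x _; rewrite /psi mul1r addrK.
Qed.

(** Leibniz rule: the weak derivative of [u] is tested against [a * phi], whose derivative is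
    [a' * phi + a * phi']. *)
Lemma jetM n (a : R -> R) (u U : R -> 'rV[R]_n) : test_function a -> jet u U ->
  jet (fun x => a x *: u x) (fun x => derive1 a x *: u x + a x *: U x).
Proof.
move=> ta [lu lU uU].
have [sa _] := (test_functionP a).1 ta.
have ta' := test_function_derive1 ta.
have [ma [M [_ aM _]]] := test_function_bounded ta.
have [ma' [M' [_ aM' _]]] := test_function_bounded ta'.
have lau := L2loc_bounded ma aM lu.
have la'u := L2loc_bounded ma' aM' lu.
have laU := L2loc_bounded ma aM lU.
split=> [//||phi i tphi].
  apply: (L2loc_le _ la'u laU (C := 2)) => x; last exact: sqnormD_le2.
  by case: la'u laU => m1 _ [m2 _]; exact: measurable_vecD.
have bphi := test_function_bounded tphi.
have taphi := test_functionM sa tphi.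
have baphi' := test_function_bounded (test_function_derive1 taphi).
have dap x : derive1 (a \* phi) x = derive1 a x * phi x + a x * derive1 phi x.
  have /test_functionP[sphi _] := tphi.
  exact: derive1_mul (@smooth_derivable _ _ sa x) (@smooth_derivable _ _ sphi x).
transitivity (\int[mu]_x (u x 0 i * derive1 (a \* phi) x - (derive1 a x *: u x) 0 i * phi x)).
  by apply: eq_Rintegral => x _; rewrite dap !mxE; ring.
rewrite RintegralB//; [|exact: L2loc_mul_integrable..].
rewrite uU//.
transitivity (- \int[mu]_x ((a x *: U x) 0 i * phi x + (derive1 a x *: u x) 0 i * phi x)).
  rewrite RintegralD//; [|exact: L2loc_mul_integrable..].
  rewrite opprD; congr (- _ - _).
  by apply: eq_Rintegral => x _; rewrite !mxE /=; ring.
by congr (- _); apply: eq_Rintegral => x _; rewrite !mxE; ring.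
Qed.

End jets.

(** * The radial truncation of L2 *)

Section L2_estimates.
Context {R : realType}.
Local Notation mu := (@lebesgue_measure R).

Definition l2 m (a : R -> 'rV[R]_m) : \bar R := (\int[mu]_x (sqnorm (a x))%:E)%E.

(* Junk value [0] when [l2 a] is infinite. *)
Definition l2norm m (a : R -> 'rV[R]_m) : R := fine (sqrte (l2 a)).

Lemma l2_ge0 m (a : R -> 'rV[R]_m) : (0 <= l2 a)%E.
Proof. by apply: integral_ge0 => x _; rewrite lee_fin sqnorm_ge0. Qed.

Lemma l2norm_ge0 m (a : R -> 'rV[R]_m) : 0 <= l2norm a.
Proof. by rewrite fine_ge0// sqrte_ge0. Qed.

Lemma l2E m (a : R -> 'rV[R]_m) : (l2 a < +oo)%E -> l2 a = (l2norm a ^+ 2)%:E.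
Proof.
move=> fa; have fin : l2 a \is a fin_num by rewrite ge0_fin_numE// l2_ge0.
by rewrite /l2norm -[LHS]sqr_sqrte ?l2_ge0// EFin_expe fineK// sqrte_fin_num// l2_ge0.
Qed.

Lemma l2normE m (a : R -> 'rV[R]_m) (c : R) : 0 <= c -> l2 a = (c ^+ 2)%:E -> l2norm a = c.
Proof. by move=> c0 ac; rewrite /l2norm ac /= sqrtr_sqr ger0_norm. Qed.

Lemma measurable_EFin_sqnorm m (a : R -> 'rV[R]_m) (D : set R) : measurable_vec a ->
  measurable_fun D (fun x => (sqnorm (a x))%:E).
Proof. by move=> ma; apply/measurable_EFinP/measurable_funTS; exact: measurable_sqnorm. Qed.

Lemma l2Z m (c : R) (a : R -> 'rV[R]_m) : measurable_vec a ->
  l2 (fun x => c *: a x) = ((c ^+ 2)%:E * l2 a)%E.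
Proof.
move=> ma; rewrite /l2; under eq_integral do rewrite sqnormZ EFinM.
rewrite ge0_integralZl//; first exact: measurable_EFin_sqnorm.
- by move=> x _; rewrite lee_fin sqnorm_ge0.
- by rewrite lee_fin sqr_ge0.
Qed.

Lemma l2normZ m (c : R) (a : R -> 'rV[R]_m) : measurable_vec a -> (l2 a < +oo)%E ->
  l2norm (fun x => c *: a x) = `|c| * l2norm a.
Proof.
move=> ma fa; apply: l2normE; first by rewrite mulr_ge0// l2norm_ge0.
by rewrite l2Z// l2E// -EFinM exprMn real_normK// num_real.
Qed.

Lemma l2D_le m (t : R) (a b : R -> 'rV[R]_m) : 0 < t ->
  measurable_vec a -> measurable_vec b ->
  (l2 (fun x => (a x + b x)%R) <= (1 + t)%:E * l2 a + (1 + t^-1)%:E * l2 b)%E.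
Proof.
move=> t0 ma mb.
have s0 (z : R -> 'rV[R]_m) x : (0 <= (sqnorm (z x))%:E)%E by rewrite lee_fin sqnorm_ge0.
have t1 : (0 <= (1 + t)%:E)%E by rewrite lee_fin addr_ge0// ltW.
have t2 : (0 <= (1 + t^-1)%:E)%E by rewrite lee_fin addr_ge0// invr_ge0 ltW.
have m1 c (z : R -> 'rV[R]_m) : measurable_vec z ->
    measurable_fun setT (fun x => c%:E * (sqnorm (z x))%:E)%E.
  by move=> mz; apply: emeasurable_funM => //; exact: measurable_EFin_sqnorm.
rewrite /l2 -!ge0_integralZl//; [|exact: measurable_EFin_sqnorm..].
rewrite -ge0_integralD//; [|by move=> x _; rewrite mule_ge0|exact: m1
  |by move=> x _; rewrite mule_ge0|exact: m1].
apply: ge0_le_integral => //.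
- by move=> x _; rewrite lee_fin sqnorm_ge0.
- exact: measurable_EFin_sqnorm (measurable_vecD ma mb).
- by apply: emeasurable_funD; exact: m1.
- by move=> x _; rewrite lee_fin sqnormD_le.
Qed.

Lemma l2D_lty m (a b : R -> 'rV[R]_m) : measurable_vec a -> measurable_vec b ->
  (l2 a < +oo)%E -> (l2 b < +oo)%E -> (l2 (fun x => (a x + b x)%R) < +oo)%E.
Proof.
move=> ma mb fa fb; apply: le_lt_trans (l2D_le ltr01 ma mb) _.
by rewrite lte_add_pinfty// lte_mul_pinfty// lee_fin addr_ge0// invr_ge0.
Qed.

(* Weighting the square by [t = q / p], for [p] and [q] close to the two norms,
   turns the right-hand side of [l2D_le] into [(p + q) ^+ 2]. *)
Lemma l2norm_triangle m (a b : R -> 'rV[R]_m) : measurable_vec a -> measurable_vec b ->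
  (l2 a < +oo)%E -> (l2 b < +oo)%E ->
  l2norm (fun x => a x + b x) <= l2norm a + l2norm b.
Proof.
move=> ma mb fa fb; apply/ler_addgt0Pr => e e0.
pose p := l2norm a + e / 2; pose q := l2norm b + e / 2.
have na := l2norm_ge0 a; have nb := l2norm_ge0 b.
have p0 : 0 < p by rewrite /p; lra.
have q0 : 0 < q by rewrite /q; lra.
have := l2D_le (divr_gt0 q0 p0) ma mb.
rewrite (l2E (l2D_lty ma mb fa fb)) (l2E fa) (l2E fb) -!EFinM -EFinD lee_fin => h.
have -> : l2norm a + l2norm b + e = p + q by rewrite /p /q; lra.
rewrite -ler_sqr ?nnegrE ?l2norm_ge0//; last by apply: addr_ge0; exact: ltW.
apply: le_trans h _.
have -> : (p + q) ^+ 2 = (1 + q / p) * p ^+ 2 + (1 + (q / p)^-1) * q ^+ 2.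
  by field; rewrite !gt_eqF.
have qp := divr_gt0 q0 p0; have qp' : 0 < (q / p)^-1 by rewrite invr_gt0.
by apply: lerD; rewrite ler_pM2l ?addr_gt0// ler_sqr ?nnegrE ?(ltW p0) ?(ltW q0)// /p /q; lra.
Qed.

Lemma l2B_lty m (a b : R -> 'rV[R]_m) : measurable_vec a -> measurable_vec b ->
  (l2 a < +oo)%E -> (l2 b < +oo)%E -> (l2 (fun x => (a x - b x)%R) < +oo)%E.
Proof.
move=> ma mb fa fb; apply: l2D_lty => //; first exact: measurable_vecN.
by rewrite /l2; under eq_integral do rewrite sqnormN.
Qed.

Lemma l2norm_distC m (a b : R -> 'rV[R]_m) :
  l2norm (fun x => a x - b x) = l2norm (fun x => b x - a x).
Proof.
rewrite /l2norm /l2; congr (fine (sqrte _)); apply: eq_integral => x _.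
by rewrite -opprB sqnormN.
Qed.

Lemma l2norm_dist m (a b : R -> 'rV[R]_m) : measurable_vec a -> measurable_vec b ->
  (l2 a < +oo)%E -> (l2 b < +oo)%E ->
  `|l2norm a - l2norm b| <= l2norm (fun x => a x - b x).
Proof.
move=> ma mb fa fb.
have h (c d : R -> 'rV[R]_m) : measurable_vec c -> measurable_vec d ->
    (l2 c < +oo)%E -> (l2 d < +oo)%E ->
    l2norm c <= l2norm (fun x => c x - d x) + l2norm d.
  move=> mc md fc fd.
  have := l2norm_triangle (measurable_vecB mc md) md (l2B_lty mc md fc fd) fd.
  by under eq_fun do rewrite subrK.
have := h _ _ ma mb fa fb; have := h _ _ mb ma fb fa.
by rewrite l2norm_distC ler_norml => ? ?; apply/andP; split; lra.
Qed.

Section truncation.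
Variables (chi0 : R -> R).
Hypothesis hchi0 : smooth_indicator chi0.

Lemma chi0_lipschitz (x y : R) : `|chi0 x - chi0 y| <= 2 * `|x - y|.
Proof.
wlog xy : x y / x <= y => [h|].
  by have [/h//|/ltW/h] := leP x y; rewrite distrC [X in _ * X]distrC.
case: hchi0 => s0 _ _ d0; rewrite distrC [X in _ * X]distrC.
have cw : {within `[x, y], continuous chi0}.
  exact/continuous_subspaceT/smooth_continuous.
have [c _ ->] := MVT_segment xy (fun c _ => derivableP (@smooth_derivable _ _ s0 c)) cw.
by rewrite normrM ler_wpM2r// -derive1E; have /andP[] := d0 c.
Qed.

(* [chi0] is not assumed to take its values in [0, 1]. *)
Lemma chi0_le5 (x : R) : `|chi0 x| <= 5.
Proof.
case: hchi0 => _ c2 c1 _; have [x2|/c2->] := leP `|x| 2; last by rewrite normr0.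
(* On [[-2, 2]] the Lipschitz constant 2 gives distance at most 4 from the value 1 at the origin. *)
have := chi0_lipschitz x 0; rewrite subr0 (c1 0) ?normr0// => h.
by have := ler_normB (chi0 x - 1) (- 1); rewrite opprK subrK normrN normr1; lra.
Qed.

(** If both norms exceed 2, both truncations vanish. Otherwise, by symmetry, [b] has norm at most 2,
    and with [p], [q] the two cut-off factors the difference is [p (a - b) + (p - q) b]; the vector
    beside [p - q] has to be the one of controlled norm. The constant is the square of 9. *)
Lemma truncation_lipschitz m (a b : R -> 'rV[R]_m) : measurable_vec a -> measurable_vec b ->
  (l2 a < +oo)%E -> (l2 b < +oo)%E ->
  (l2 (fun x => (chi0 (l2norm a) *: a x - chi0 (l2norm b) *: b x)%R)
   <= 81%:E * l2 (fun x => (a x - b x)%R))%E.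
Proof.
wlog b2 : a b / l2norm b <= 2 => [h ma mb fa fb|ma mb fa fb].
  have [b2|b2] := leP (l2norm b) 2; first exact: h.
  have [a2|a2] := leP (l2norm a) 2.
    have := h b a a2 mb ma fb fa; rewrite /l2.
    by under eq_integral do rewrite -opprB sqnormN;
      under [X in (_ <= _ * X)%E]eq_integral do rewrite -opprB sqnormN.
  case: hchi0 => _ c2 _ _; rewrite !c2 ?ger0_norm ?l2norm_ge0//.
  rewrite /l2; under eq_integral do rewrite !scale0r subrr sqnorm0.
  by rewrite integral0 mule_ge0// l2_ge0.
have mab := measurable_vecB ma mb; have fab := l2B_lty ma mb fa fb.
set p := chi0 (l2norm a); set q := chi0 (l2norm b).
have fZ (c : R) (z : R -> 'rV[R]_m) : measurable_vec z -> (l2 z < +oo)%E ->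
    (l2 (fun x => (c *: z x)%R) < +oo)%E.
  by move=> mz fz; rewrite l2Z// lte_mul_pinfty// lee_fin sqr_ge0.
have mZ (c : R) (z : R -> 'rV[R]_m) : measurable_vec z -> measurable_vec (fun x => c *: z x).
  by move=> mz; exact: measurable_vecZ.
(* [|p| <= 5] and [|p - q| |b| <= 2 |a - b| * 2], hence the constant [9]. *)
rewrite (_ : (fun x => _) = (fun x => p *: (a x - b x) + (p - q) *: b x)); last first.
  by apply/funext => x; rewrite scalerBr scalerBl addrA subrK.
have := l2norm_triangle (mZ p _ mab) (mZ (p - q) _ mb) (fZ p _ mab fab) (fZ (p - q) _ mb fb).
rewrite !l2normZ// => h.
rewrite (l2E fab) l2E; last by apply: l2D_lty; [exact: mZ|exact: mZ|exact: fZ|exact: fZ].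
have -> : 81 = 9 ^+ 2 :> R by rewrite expr2; lra.
rewrite -EFinM lee_fin -exprMn ler_sqr ?nnegrE ?mulr_ge0 ?l2norm_ge0//.
apply: le_trans h _; have pq := chi0_lipschitz (l2norm a) (l2norm b).
have d := l2norm_dist ma mb fa fb.
have p5 := chi0_le5 (l2norm a); rewrite -/p -/q in pq p5.
have := l2norm_ge0 b; have := l2norm_ge0 (fun x => a x - b x).
set D := l2norm (fun x => a x - b x) in d *; set B := l2norm b in b2 pq d *.
move=> D0 B0; have p0 := normr_ge0 p; have pq0 := normr_ge0 (p - q).
have : `|p| * D <= 5 * D by rewrite ler_wpM2r.
have : `|p - q| * B <= 2 * D * 2 by apply: ler_pM => //; lra.
lra.
Qed.

(** Either the factor vanishes or it is at most 5 on a vector of norm at most 2; the constant is the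
    square of 10. *)
Lemma truncation_bounded m (a : R -> 'rV[R]_m) : measurable_vec a -> (l2 a < +oo)%E ->
  (l2 (fun x => (chi0 (l2norm a) *: a x)%R) <= 100%:E)%E.
Proof.
move=> ma fa; rewrite l2Z// l2E// -EFinM lee_fin.
have := l2norm_ge0 a; have := chi0_le5 (l2norm a); have [_ c2 _ _] := hchi0.
have [a2|a2] := leP (l2norm a) 2.
  rewrite -[X in X * _]real_normK ?num_real//.
  move: a2; set A := l2norm a; set p := `|chi0 A| => a2 p5 A0.
  have p0 : 0 <= p by exact: normr_ge0.
  rewrite -exprMn (_ : 100 = 10 ^+ 2); last by rewrite expr2; lra.
  rewrite ler_sqr ?nnegrE ?mulr_ge0//.
  have : p * A <= 5 * 2 by exact: ler_pM.
  lra.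
by rewrite c2 ?expr0n ?mul0r// ger0_norm// l2norm_ge0.
Qed.

End truncation.

End L2_estimates.

(** * Jensen and Fubini *)

Section product_integrals.
Context {R : realType}.
Local Notation mu := (@lebesgue_measure R).

(** Cauchy-Schwarz against the constant 1 on an interval of length [L], obtained by integrating
    [2 * t * f <= f ^+ 2 + t ^+ 2]. When [f] is not square-integrable the right-hand side is
    infinite. *)
Lemma jensen_interval (c L : R) (f : R -> R) : 0 < L ->
  mu.-integrable setT (EFin \o f) -> (forall y, f y != 0 -> c <= y <= c + L) ->
  (((\int[mu]_y f y) ^+ 2)%:E <= L%:E * \int[mu]_y (f y ^+ 2)%:E)%E.
Proof.
move=> L0 fi fs; set F := \int[mu]_y f y.
have mf : measurable_fun setT f by have /integrableP[/measurable_EFinP] := fi.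
have f20 x : (0 <= (f x ^+ 2)%:E)%E by rewrite lee_fin sqr_ge0.
have mf2 : measurable_fun setT (fun x => (f x ^+ 2)%:E).
  by apply/measurable_EFinP; exact: measurable_funX.
have [fin|] := boolP ((\int[mu]_y (f y ^+ 2)%:E)%E \is a fin_num); last first.
  rewrite ge0_fin_numE ?integral_ge0// -leNgt leye_eq => /eqP ->.
  by rewrite gt0_muley ?leey.
have f2i : mu.-integrable setT (fun x => (f x ^+ 2)%:E).
  apply/integrableP; split=> //; under eq_integral do rewrite gee0_abs//.
  by move: fin; rewrite ge0_fin_numE// integral_ge0.
have mI : measurable `[c, c + L]%classic by exact: measurable_itv.
have intI (k : R) : \int[mu]_(y in `[c, c + L]) k = k * L.
  rewrite Rintegral_cst//= lebesgue_measure_itv/= lte_fin ltrDl L0 -EFinD.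
  by rewrite addrAC subrr add0r.
have restr (g : R -> R) : (forall y, g y != 0 -> c <= y <= c + L) ->
    \int[mu]_y g y = \int[mu]_(y in `[c, c + L]) g y.
  move=> gs; rewrite [RHS]Rintegral_mkcond; apply: eq_Rintegral => y _.
  rewrite patchE; case: ifPn => //; rewrite notin_setE/= in_itv/= => /negP.
  by apply: contraNeq; exact: gs.
have EF : F = \int[mu]_(y in `[c, c + L]) f y by exact: restr.
have EF2 : fine (\int[mu]_y (f y ^+ 2)%:E)%E = \int[mu]_(y in `[c, c + L]) f y ^+ 2.
  by apply: restr => y; rewrite sqrf_eq0; exact: fs.
rewrite -(fineK fin) -EFinM lee_fin EF2.
have iI (g : R -> R) : mu.-integrable setT (EFin \o g) ->
    mu.-integrable `[c, c + L] (EFin \o g).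
  by move=> gi; apply: integrableS gi.
(* The mean of [f] over the interval, which maximises [2 * t * F - t ^+ 2 * L], with maximum
   [F ^+ 2 / L]. *)
pose t := F / L.
have ci (k : R) : mu.-integrable `[c, c + L] (EFin \o cst k).
  apply: continuous_compact_integrable; first exact: segment_compact.
  by apply: continuous_subspaceT => x; exact: cvg_cst.
have : \int[mu]_(y in `[c, c + L]) (2 * t * f y) <=
       \int[mu]_(y in `[c, c + L]) (f y ^+ 2 + t ^+ 2).
  apply: le_Rintegral => //.
  - rewrite (_ : _ \o _ = fun x => (2 * t)%:E * (f x)%:E)%E.
      by apply: integrableZl => //; exact: iI.
    by apply/funext => x /=; rewrite EFinM.
  - rewrite (_ : _ \o _ = fun x => (f x ^+ 2)%:E + (t ^+ 2)%:E)%E.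
      by apply: integrableD => //; [exact: (iI (fun y => f y ^+ 2))|exact: ci].
    by apply/funext => x /=; rewrite EFinD.
  - by move=> x _; have := sqr_ge0 (f x - t); nra.
rewrite RintegralZl//; last exact: iI.
rewrite RintegralD//; [|exact: iI|exact: ci].
rewrite -EF intI => h.
rewrite -(ler_pM2l (_ : 0 < L^-1)) ?invr_gt0// mulKf ?gt_eqF//.
move: h; rewrite /t.
have -> : 2 * (F / L) * F = 2 * (L^-1 * F ^+ 2) by field; rewrite gt_eqF.
have -> : (F / L) ^+ 2 * L = L^-1 * F ^+ 2 by field; rewrite gt_eqF.
lra.
Qed.

Lemma jensen_vec m (c L : R) (h : R -> 'rV[R]_m) : 0 < L ->
  (forall i, mu.-integrable setT (fun y => (h y 0 i)%:E)) ->
  (forall y, h y != 0 -> c <= y <= c + L) ->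
  ((sqnorm (\row_i \int[mu]_y h y 0 i))%:E <= L%:E * l2 h)%E.
Proof.
move=> L0 hi hs; rewrite /l2 /sqnorm.
under [X in (_ <= _ * X)%E]eq_integral do rewrite -sumEFin.
rewrite ge0_integral_sum//; last 2 first.
- move=> i; apply/measurable_EFinP/measurable_funX.
  by have /integrableP[/measurable_EFinP] := hi i.
- by move=> i y _; rewrite lee_fin sqr_ge0.
rewrite -sumEFin ge0_sume_distrr; last first.
  by move=> i _; apply: integral_ge0 => x _; rewrite lee_fin sqr_ge0.
apply: lee_sum => i _; rewrite mxE; apply: jensen_interval => // [|y hy].
  exact: hi.
by apply: hs; apply: contraNneq hy => ->; rewrite mxE.
Qed.

(** Tonelli gives measurability of the partial integrals of the positive and negative parts
    separately; [fine] of their difference is then measurable. *)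
Lemma measurable_Rintegral (f : R * R -> R) : measurable_fun setT f ->
  measurable_fun setT (fun x => \int[mu]_y f (x, y)).
Proof.
move=> mf; apply: measurableT_comp; first exact: fine_measurable.
under eq_fun do rewrite integralE.
have mEf : measurable_fun setT (EFin \o f) by exact/measurable_EFinP.
apply: emeasurable_funB.
  have := @measurable_fun_fubini_tonelli_F _ _ _ _ _ mu ((EFin \o f)^\+)%E
    (measurable_funepos mEf) (fun z => funepos_ge0 _ z).
  apply: eq_measurable_fun => x _; apply: eq_integral => y _.
  by rewrite !funeposE.
have := @measurable_fun_fubini_tonelli_F _ _ _ _ _ mu ((EFin \o f)^\-)%E
  (measurable_funeneg mEf) (fun z => funeneg_ge0 _ z).
apply: eq_measurable_fun => x _; apply: eq_integral => y _.
by rewrite !funenegE.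
Qed.

(** The product bound holds at every point, so not only is [f] integrable on the plane but every
    section is integrable; thus [fine] never discards an infinite inner integral. *)
Lemma Rintegral_Fubini (f : R * R -> R) (b c : R -> R) : measurable_fun setT f ->
  mu.-integrable setT (EFin \o b) -> mu.-integrable setT (EFin \o c) ->
  (forall x y, `|f (x, y)| <= b x * c y) ->
  \int[mu]_x \int[mu]_y f (x, y) = \int[mu]_y \int[mu]_x f (x, y).
Proof.
move=> mf ib ic fbc.
have /integrableP[/measurable_EFinP mb _] := ib.
have /integrableP[/measurable_EFinP mc _] := ic.
have mEf : measurable_fun setT (EFin \o f) by exact/measurable_EFinP.
have fx x : mu.-integrable setT (fun y => (f (x, y))%:E).
  apply: (le_integrable measurableT _ _ (integrableZl measurableT (b x) ic)).
    by apply/measurable_EFinP; exact: measurableT_comp.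
  by move=> y _; rewrite -EFinM/= lee_fin (le_trans (fbc x y))// ler_norm.
have fy y : mu.-integrable setT (fun x => (f (x, y))%:E).
  apply: (le_integrable measurableT _ _ (integrableZl measurableT (c y) ib)).
    by apply/measurable_EFinP; exact: measurableT_comp.
  by move=> x _; rewrite -EFinM/= lee_fin (le_trans (fbc x y))// mulrC ler_norm.
have fint : (mu \x mu)%E.-integrable setT (EFin \o f).
  apply/integrable12ltyP => //=.
  apply: (@le_lt_trans _ _ (\int[mu]_x (`|b x|%:E * \int[mu]_y `|c y|%:E))%E).
    apply: ge0_le_integral => //.
    - by move=> x _; apply: integral_ge0.
    - apply: (@measurable_fun_fubini_tonelli_F _ _ _ _ _ mu (fun z => `|f z|%:E)) => //.
      by apply/measurable_EFinP; exact: measurableT_comp.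
    - apply: emeasurable_funM => //; apply/measurable_EFinP; exact: measurableT_comp.
    - move=> x _; rewrite -ge0_integralZl//; last first.
        by apply/measurable_EFinP; exact: measurableT_comp.
      apply: ge0_le_integral => //.
      + by apply/measurable_EFinP; apply: measurableT_comp => //; exact: measurableT_comp.
      + by apply: emeasurable_funM => //; apply/measurable_EFinP; exact: measurableT_comp.
      + by move=> y _; rewrite -EFinM lee_fin -normrM (le_trans (fbc x y))// ler_norm.
  rewrite ge0_integralZr//; [|by apply/measurable_EFinP; exact: measurableT_comp
    |exact: integral_ge0].
  have /integrableP[_ /= ib'] := ib; have /integrableP[_ /= ic'] := ic.
  by rewrite lte_mul_pinfty ?integral_ge0// ge0_fin_numE// integral_ge0.
have := Fubini fint => /= h.
rewrite /Rintegral; congr fine.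
transitivity (\int[mu]_x \int[mu]_y (f (x, y))%:E)%E.
  by apply: eq_integral => x _; rewrite fineK//; exact: integrable_fin_num.
rewrite h; apply: eq_integral => y _; rewrite fineK//; exact: integrable_fin_num.
Qed.

End product_integrals.

(** * The jet of the cut-off *)

Section cutoff_jets.
Context {R : realType}.
Local Notation mu := (@lebesgue_measure R).
Variables chi0 theta : R -> R.
Hypothesis hchi0 : smooth_indicator chi0.
Hypothesis htheta : partition_generator theta.
Variable K : R.
Hypothesis theta'_le : forall x, `|derive1 theta x| <= K.

Lemma K_ge0 : 0 <= K.
Proof. exact: le_trans (theta'_le 0). Qed.

Lemma theta'_far x : 5 / 4 < `|x| -> derive1 theta x = 0.
Proof. by apply: derive1_vanish => z /ltW; exact: theta_far. Qed.

Lemma theta_translate y : test_function (fun x => theta (x - y)) /\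
  derive1 (fun x => theta (x - y)) = fun x => derive1 theta (x - y).
Proof.
rewrite (_ : (fun x => theta (x - y)) = fun x => theta (1 * x + - y)); last first.
  by apply/funext => x; rewrite mul1r.
split; first by apply: test_function_affine; [exact: oner_neq0|exact: theta_test].
have /test_functionP[st _] := theta_test htheta.
apply/funext => x; have [_ ->] := derive1_affine (@smooth_derivable _ _ st (1 * x + - y)).
by rewrite !mul1r.
Qed.

Section one_function.
Variables (n : nat) (u U : R -> 'rV[R]_n).
Hypothesis uU : jet u U.

(* The 1-jet of [window theta u y] at [x], as one vector, so that its [sqnorm] is
   the H^1 energy density. *)
Definition wjet (y x : R) : 'rV[R]_(n + n) :=
  row_mx (theta (x - y) *: u x) (derive1 theta (x - y) *: u x + theta (x - y) *: U x).

(** A function of the centre [y] of the window only, hence a constant as far as differentiation in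
    [x] is concerned. *)
Definition cut_weight (y : R) : R := chi0 (l2norm (wjet y)).

(** The left half is the cut-off itself ([cutoffE]), the right half its weak derivative
    ([cutoff_jet]). *)
Definition cut_jet (x : R) : 'rV[R]_(n + n) :=
  \row_i \int[mu]_y (cut_weight y *: wjet y x) 0 i.

Lemma jet_window y : jet (window theta u y)
  (fun x => derive1 theta (x - y) *: u x + theta (x - y) *: U x).
Proof. by have [tt tt'] := theta_translate y; have := jetM tt uU; rewrite tt'. Qed.

(** The function part contributes 1 to the coefficient of [|u|^2]; the derivative part, by
    [sqnormD_le2], contributes [2 * K ^+ 2] to it and 2 to that of [|U|^2]. The constant is the sum
    of all three. *)
Lemma wjet_le y x : sqnorm (wjet y x) <= (2 * K ^+ 2 + 3) * (sqnorm (u x) + sqnorm (U x)).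
Proof.
rewrite /wjet sqnorm_row_mx.
have := sqnormD_le2 (derive1 theta (x - y) *: u x) (theta (x - y) *: U x).
rewrite !sqnormZ.
have : theta (x - y) ^+ 2 <= 1.
  by rewrite -[X in _ <= X](expr1n _ 2) ler_sqr ?nnegrE ?theta_le1// theta_ge0.
have : derive1 theta (x - y) ^+ 2 <= K ^+ 2.
  by rewrite -[X in X <= _]real_normK ?num_real// ler_sqr ?nnegrE ?K_ge0.
have := sqnorm_ge0 (u x); have := sqnorm_ge0 (U x).
set a := sqnorm (u x); set b := sqnorm (U x); set p := _ ^+ 2; set q := theta _ ^+ 2.
move=> b0 a0 pK q1 h.
have : p * a <= K ^+ 2 * a by rewrite ler_wpM2r.
have : q * a <= 1 * a by rewrite ler_wpM2r.
have : q * b <= 1 * b by rewrite ler_wpM2r.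
have : 0 <= K ^+ 2 * b by rewrite mulr_ge0// sqr_ge0.
lra.
Qed.

Lemma wjet_far y x : 5 / 4 < `|x - y| -> wjet y x = 0.
Proof.
move=> xy; rewrite /wjet theta'_far// (theta_far htheta (ltW xy)) !scale0r addr0.
exact: row_mx0.
Qed.

Lemma measurable_wjet : measurable_vec (fun z : R * R => wjet z.2 z.1).
Proof.
have [[mu' _] [mU _] _] := uU.
have md : measurable_fun setT (fun z : R * R => z.1 - z.2).
  by apply: measurable_funB; [exact: measurable_fst|exact: measurable_snd].
have /test_functionP[st _] := theta_test htheta.
have mt : measurable_fun setT (fun z : R * R => theta (z.1 - z.2)).
  by apply: measurableT_comp md; exact: smooth_measurable.
have mt' : measurable_fun setT (fun z : R * R => derive1 theta (z.1 - z.2)).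
  by apply: measurableT_comp md; exact: smooth_measurable (smooth_derive1 st).
have mu1 : measurable_vec (fun z : R * R => u z.1).
  exact: measurable_vec_comp mu' measurable_fst.
have mU1 : measurable_vec (fun z : R * R => U z.1).
  exact: measurable_vec_comp mU measurable_fst.
apply: measurable_vec_row_mx; first exact: measurable_vecZ.
by apply: measurable_vecD; exact: measurable_vecZ.
Qed.

Lemma measurable_wjet1 y : measurable_vec (wjet y).
Proof.
exact: (measurable_vec_comp measurable_wjet (f := fun x => (x, y)) (pair2_measurable y)).
Qed.

Lemma measurable_wjet2 x : measurable_vec (fun y => wjet y x).
Proof.
exact: (measurable_vec_comp measurable_wjet (f := fun y => (x, y)) (pair1_measurable x)).
Qed.

(** The window vanishes off a compact interval, so local square-integrability suffices and no growth
    condition on [u] enters. *)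
Lemma l2_wjet_lty y : (l2 (wjet y) < +oo)%E.
Proof.
pose J := `[y - 5 / 4, y + 5 / 4]%classic.
have cJ : compact J by exact: segment_compact.
have mJ : measurable J by exact: compact_measurable.
have [_ fw] : L2loc (wjet y).
  have [lu lU _] := uU.
  by apply: (L2loc_le (measurable_wjet1 y) lu lU) => x; exact: wjet_le.
suff -> : l2 (wjet y) = (\int[mu]_(x in J) (sqnorm (wjet y x))%:E)%E by exact: fw.
rewrite [RHS]integral_mkcond; apply: eq_integral => x _; rewrite patchE.
case: ifPn => //; rewrite notin_setE /J/= in_itv/= => /negP xJ.
rewrite wjet_far ?sqnorm0//; move: xJ; apply: contraNT; rewrite -leNgt ler_norml.
by move=> /andP[? ?]; apply/andP; split; lra.
Qed.

Lemma normH1_window y : normH1 (window theta u y) = sqrte (l2 (wjet y)).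
Proof.
rewrite /normH1 (H1norm_jet htheta (jet_window y))//; congr sqrte.
by apply: eq_integral => x _; rewrite mul1r sqnorm_row_mx.
Qed.

Lemma H1_window y : H1 (window theta u y).
Proof.
split; first exact: jet_H1loc (jet_window y).
rewrite normH1_window -ge0_fin_numE ?sqrte_ge0// sqrte_fin_num ?l2_ge0//.
by rewrite ge0_fin_numE ?l2_ge0// l2_wjet_lty.
Qed.

Lemma cut_weightE y : chi0 (fine (normH1 (window theta u y))) = cut_weight y.
Proof. by rewrite normH1_window. Qed.

Lemma measurable_cut_weight : measurable_fun setT cut_weight.
Proof.
have [s0 _ _ _] := hchi0.
apply: measurableT_comp; first exact: smooth_measurable.
(* The energies are finite, so [fine] may be moved inside the root; there the real square root is
   continuous and Tonelli gives measurability in [y]. *)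
rewrite (_ : (fun y => l2norm (wjet y)) = fun y => Num.sqrt (fine (l2 (wjet y)))).
  apply: measurableT_comp.
    by apply: continuous_measurable_fun; exact: sqrt_continuous.
  apply: measurableT_comp; first exact: fine_measurable.
  apply: (@measurable_fun_fubini_tonelli_G _ _ _ _ _ mu
    (fun z => (sqnorm (wjet z.2 z.1))%:E)).
    by apply/measurable_EFinP; exact: measurable_sqnorm measurable_wjet.
  by move=> z; rewrite lee_fin sqnorm_ge0.
apply/funext => y; rewrite /l2norm.
have := l2_wjet_lty y; rewrite -ge0_fin_numE ?l2_ge0// => /fineK <-.
by [].
Qed.

Lemma measurable_cut_wjet :
  measurable_vec (fun z : R * R => cut_weight z.2 *: wjet z.2 z.1).
Proof.
apply: measurable_vecZ; last exact: measurable_wjet.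
by apply: measurableT_comp measurable_cut_weight _; exact: measurable_snd.
Qed.

Lemma cut_wjet_far x y : 5 / 4 < `|x - y| -> cut_weight y *: wjet y x = 0.
Proof. by move=> xy; rewrite wjet_far// scaler0. Qed.

Lemma cut_wjet_supp x y : cut_weight y *: wjet y x != 0 ->
  x - 5 / 4 <= y <= x - 5 / 4 + 5 / 2.
Proof.
move=> h; have : `|x - y| <= 5 / 4.
  by rewrite leNgt; apply: contraNN h => /cut_wjet_far ->.
by rewrite ler_norml => /andP[? ?]; apply/andP; split; lra.
Qed.

Lemma cut_wjet_le x y : sqnorm (cut_weight y *: wjet y x) <=
  25 * (2 * K ^+ 2 + 3) * (sqnorm (u x) + sqnorm (U x)).
Proof.
rewrite sqnormZ -mulrA; apply: ler_pM; [exact: sqr_ge0|exact: sqnorm_ge0| |exact: wjet_le].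
rewrite -[X in X <= _]real_normK ?num_real// (_ : 25 = 5 ^+ 2); last by rewrite expr2; lra.
by rewrite ler_sqr ?nnegrE//; exact: (chi0_le5 hchi0).
Qed.

Lemma cut_wjet_bounded_support x i :
  bounded_support (fun y => (cut_weight y *: wjet y x) 0 i).
Proof.
split; first exact: (measurable_vec_comp measurable_cut_wjet
  (f := fun y => (x, y)) (pair1_measurable x)).
set B := 25 * (2 * K ^+ 2 + 3) * (sqnorm (u x) + sqnorm (U x)).
have B0 : 0 <= B by apply: le_trans (cut_wjet_le x x); exact: sqnorm_ge0.
(* One number for two purposes: [1 + B] bounds any [s] with [s ^+ 2 <= B], and [|x| + 5 / 4] bounds
   the support in [y]. *)
exists (1 + B + `|x| + 5 / 4); have x0 := normr_ge0 x; split.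
- by lra.
- move=> y; have := le_trans (sqr_le_sqnorm _ i) (cut_wjet_le x y).
  rewrite -/B -[X in X <= _]real_normK ?num_real//; set a := `|_| => h.
  have := sqr_ge0 (a - 1); nra.
- move=> y h; rewrite cut_wjet_far ?mxE// distrC.
  have := ler_distD 0 y x; rewrite !subr0 sub0r normrN.
  by have := lerB_dist y x; lra.
Qed.

Lemma cut_wjet_integrable x i :
  mu.-integrable setT (fun y => ((cut_weight y *: wjet y x) 0 i)%:E).
Proof. exact: bounded_support_integrable (cut_wjet_bounded_support x i). Qed.

Lemma cut_jet_jensen x :
  ((sqnorm (cut_jet x))%:E <= (5 / 2)%:E * \int[mu]_y (sqnorm (cut_weight y *: wjet y x))%:E)%E.
Proof.
apply: jensen_vec; [by lra|exact: cut_wjet_integrable|exact: cut_wjet_supp].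
Qed.

Lemma measurable_cut_jet : measurable_vec cut_jet.
Proof.
move=> i; under eq_fun do rewrite mxE.
exact: (measurable_Rintegral (measurable_cut_wjet i)).
Qed.

Lemma cutoffE : cutoff chi0 theta u = fun x => lsubmx (cut_jet x).
Proof.
apply/funext => x; apply/rowP => i; rewrite !mxE; apply: eq_Rintegral => y _.
by rewrite /cutoff_integrand cut_weightE -scalerA !mxE (unsplitK (inl _ i)) mxE.
Qed.

(** A pointwise bound in [x]: one factor [5 / 2] comes from Jensen, the other from integrating
    [cut_wjet_le] over the [y] with [|x - y| <= 5 / 4]. *)
Lemma cut_jet_L2loc : L2loc cut_jet.
Proof.
have [lu lU _] := uU; pose B := 25 * (2 * K ^+ 2 + 3).
apply: (L2loc_le measurable_cut_jet lu lU (C := 5 / 2 * (B * (5 / 2)))) => x.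
rewrite -lee_fin; apply: le_trans (cut_jet_jensen x) _.
pose J := `[x - 5 / 4, x + 5 / 4]%classic.
have mJ : measurable J by exact: measurable_itv.
set q := _ + _.
apply: (@le_trans _ _ ((5 / 2)%:E * \int[mu]_(y in J) (B * q)%:E)%E).
  rewrite lee_wpmul2l//.
  rewrite [leRHS]integral_mkcond; apply: ge0_le_integral => //.
  - by move=> y _; rewrite lee_fin sqnorm_ge0.
  - apply/measurable_EFinP/measurable_sqnorm.
    exact: (measurable_vec_comp measurable_cut_wjet (f := fun y => (x, y)) (pair1_measurable x)).
  - by apply: (measurable_restrictT _ _).1.
  - move=> y _; rewrite patchE; case: ifPn => [_|]; first by rewrite lee_fin cut_wjet_le.
    rewrite notin_setE /J/= in_itv/= => /negP xJ.
    rewrite cut_wjet_far ?sqnorm0//; move: xJ; apply: contraNT; rewrite -leNgt ler_norml.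
    by move=> /andP[? ?]; apply/andP; split; lra.
rewrite integral_cst//= lebesgue_measure_itv/= lte_fin ifT; last by lra.
by rewrite -EFinD -!EFinM lee_fin le_eqVlt; apply/orP; left; apply/eqP; field.
Qed.

(** Isolates the [x]-integral against [phi] for each fixed [y], where the weak derivative of a
    single window can be used. It is applied to the two halves of [wjet]. *)
Lemma cut_weight_swap (w : R * R -> R) (b phi : R -> R) : measurable_fun setT w ->
  bounded_support phi -> mu.-integrable setT (fun x => (b x * phi x)%:E) ->
  (forall x y, `|w (x, y)| <= b x) -> (forall x y, 5 / 4 < `|x - y| -> w (x, y) = 0) ->
  \int[mu]_x ((\int[mu]_y (cut_weight y * w (x, y))) * phi x) =
  \int[mu]_y (cut_weight y * \int[mu]_x (w (x, y) * phi x)).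
Proof.
move=> mw [mphi [M [M0 phiM phi0]]] ib wb w0.
have mg := measurable_cut_weight.
have g5 y : `|cut_weight y| <= 5 by exact: (chi0_le5 hchi0).
have b0 x : 0 <= b x by apply: le_trans (wb x x).
have mwx x : measurable_fun setT (fun y => w (x, y)).
  by apply: measurableT_comp mw _; exact: pair1_measurable.
have mwy y : measurable_fun setT (fun x => w (x, y)).
  by apply: measurableT_comp mw _; exact: pair2_measurable.
have wgi x : mu.-integrable setT (fun y => (cut_weight y * w (x, y))%:E).
  apply: bounded_support_integrable; split; first exact: measurable_funM.
  exists (5 * b x + `|x| + 5 / 4); have bx := b0 x; have x0 := normr_ge0 x; split.
  - lra.
  - move=> y; rewrite normrM (@le_trans _ _ (5 * b x))//; last lra.
    exact: ler_pM.
  - move=> y h; rewrite w0 ?mulr0// distrC.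
    have := ler_distD 0 y x; rewrite !subr0 sub0r normrN.
    by have := lerB_dist y x; lra.
have wpi y : mu.-integrable setT (fun x => (w (x, y) * phi x)%:E).
  apply: le_integrable ib => //.
    by apply/measurable_EFinP; exact: measurable_funM (mwy y) mphi.
  move=> x _; rewrite lee_fin !normrM ler_wpM2r// (le_trans (wb x y))//.
  exact: ler_norm.
(* From [|x| <= M] and [|x - y| <= 5 / 4] follows [|y| <= M + 2], so this indicator dominates in the
   variable [y]. *)
pose c : R -> R := \1_(`[- (M + 2), M + 2]%classic).
have ci : mu.-integrable setT (EFin \o c).
  by apply: integrable_indic_itv.
transitivity (\int[mu]_x \int[mu]_y (cut_weight y * w (x, y) * phi x)).
  by apply: eq_Rintegral => x _; rewrite RintegralZr//; exact: wgi.
rewrite (@Rintegral_Fubini _ (fun z => cut_weight z.2 * w z * phi z.1)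
    (fun x => 5 * `|b x * phi x|) c) //.
- apply: eq_Rintegral => y _ /=; rewrite -RintegralZl//; last exact: wpi.
  by apply: eq_Rintegral => x _; rewrite mulrA.
- have mg2 : measurable_fun setT (fun z : R * R => cut_weight z.2).
    exact: measurableT_comp mg measurable_snd.
  have mphi1 : measurable_fun setT (fun z : R * R => phi z.1).
    exact: measurableT_comp mphi measurable_fst.
  exact: measurable_funM (measurable_funM mg2 mw) mphi1.
- rewrite (_ : _ \o _ = fun x => 5%:E * `|b x * phi x|%:E)%E.
    by apply: integrableZl => //; exact: (integrable_norm ib).
  by apply/funext => x /=; rewrite EFinM.
- move=> x y /=; have [xM|xM] := leP `|x| M; last first.
    by rewrite phi0// mulr0 normr0 mulr_ge0// mulr_ge0.
  have [xy|xy] := leP `|x - y| (5 / 4); last first.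
    by rewrite w0// mulr0 mul0r normr0 mulr_ge0// mulr_ge0.
  rewrite /c indicE mem_set ?mulr1/=; last first.
    rewrite in_itv/= -ler_norml; have := ler_distD 0 y x.
    by have := lerB_dist y x; rewrite distrC; lra.
  rewrite !normrM (ger0_norm (b0 x)) mulrA ler_wpM2r//.
  exact: ler_pM.
Qed.

(** After exchanging the integrals, [jet_window] is applied with [y] fixed and [cut_weight y]
    constant; a second exchange returns to the integral over [x]. *)
Lemma cutoff_jet : jet (cutoff chi0 theta u) (fun x => rsubmx (cut_jet x)).
Proof.
have mc := measurable_cut_jet.
have cl x : sqnorm (cut_jet x) = sqnorm (lsubmx (cut_jet x)) + sqnorm (rsubmx (cut_jet x)).
  by rewrite -sqnorm_row_mx hsubmxK.
have llc : L2loc (fun x => lsubmx (cut_jet x)).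
  apply: (L2loc_leZ _ cut_jet_L2loc (C := 1)) => [i|x].
    under eq_fun do rewrite [_ _ 0 i]mxE; exact: mc.
  by rewrite cl mul1r lerDl sqnorm_ge0.
have lrc : L2loc (fun x => rsubmx (cut_jet x)).
  apply: (L2loc_leZ _ cut_jet_L2loc (C := 1)) => [i|x].
    under eq_fun do rewrite [_ _ 0 i]mxE; exact: mc.
  by rewrite cl mul1r lerDr sqnorm_ge0.
rewrite cutoffE; split=> // phi i tphi.
have bphi := test_function_bounded tphi.
have bphi' := test_function_bounded (test_function_derive1 tphi).
have [lu lU _] := uU.
have Nint (v : R -> 'rV[R]_n) psi : L2loc v -> bounded_support psi ->
    mu.-integrable setT (fun x => (`|v x 0 i| * psi x)%:E).
  move=> lv bpsi; have h := L2loc_mul_integrable i lv bpsi.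
  apply: le_integrable h => //.
    apply/measurable_EFinP; apply: measurable_funM; last by case: bpsi.
    by apply: measurableT_comp => //; case: lv => mv _; exact: mv.
  by move=> x _; rewrite lee_fin !normrM normr_id.
transitivity (\int[mu]_x ((\int[mu]_y (cut_weight y * wjet y x 0 (lshift n i))) * derive1 phi x)).
  apply: eq_Rintegral => x _; congr (_ * _); rewrite !mxE.
  by apply: eq_Rintegral => y _; rewrite !mxE.
rewrite (@cut_weight_swap (fun z => wjet z.2 z.1 0 (lshift n i)) (fun x => `|u x 0 i|))//;
  [|exact: measurable_wjet|exact: Nint| |by move=> x y xy /=; rewrite wjet_far ?mxE].
2: move=> x y /=; rewrite /wjet row_mxEl mxE normrM ler_piMl//.
2: by rewrite ger0_norm ?theta_le1// theta_ge0.
(* The minus sign of integration by parts is absorbed into the test function, so that both sides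
   have the shape treated by [cut_weight_swap]. *)
have bnphi : bounded_support (fun x => - phi x).
  case: bphi => mphi [M [M0 phiM phi0]]; split; first exact: measurableT_comp.
  exists M; split=> // x; first by rewrite normrN.
  by move=> /phi0 ->; rewrite oppr0.
have RN (f : R -> R) : mu.-integrable setT (fun x => (f x)%:E) ->
    \int[mu]_x (- f x) = - \int[mu]_x f x.
  by move=> fi; rewrite -[RHS]mulN1r -RintegralZl//; under eq_Rintegral do rewrite -mulN1r.
transitivity (\int[mu]_x ((\int[mu]_y (cut_weight y * wjet y x 0 (rshift n i))) * - phi x)).
  rewrite (@cut_weight_swap (fun z => wjet z.2 z.1 0 (rshift n i))
    (fun x => K * `|u x 0 i| + `|U x 0 i|));
    [|exact: measurable_wjet|exact: bnphi| | |by move=> x y xy /=; rewrite wjet_far ?mxE].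
  - apply: eq_Rintegral => y _; congr (_ * _).
    have [_ lW /(_ phi i tphi)] := jet_window y.
    rewrite -RN; last exact: L2loc_mul_integrable.
    move=> h; transitivity (\int[mu]_x (window theta u y x 0 i * derive1 phi x)).
      by apply: eq_Rintegral => x _; rewrite /wjet row_mxEl.
    by rewrite h; apply: eq_Rintegral => x _; rewrite /wjet row_mxEr mulrN.
  - have := integrableD measurableT (integrableZl measurableT K (Nint u _ lu bnphi))
      (Nint U _ lU bnphi).
    by apply: eq_integrable => // x _ /=; rewrite -EFinM -EFinD; congr EFin; ring.
  - move=> x y /=; rewrite /wjet row_mxEr !mxE (le_trans (ler_normD _ _))// !normrM.
    apply: lerD; first exact: ler_wpM2r.
    by rewrite ler_piMl// ger0_norm ?theta_le1// theta_ge0.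
rewrite -RN; last exact: L2loc_mul_integrable.
apply: eq_Rintegral => x _; rewrite -mulrN; congr (_ * _); rewrite !mxE.
by apply: eq_Rintegral => y _; rewrite !mxE.
Qed.

End one_function.
End cutoff_jets.

(** * The Lipschitz estimate and the uniform bound *)

Section estimates.
Context {R : realType}.
Local Notation mu := (@lebesgue_measure R).

(** Jensen in [y] at each [x], then Tonelli. The weight is arbitrary because both the exponential
    weight and the indicator of a unit interval are needed. *)
Lemma weighted_jensen m (h : R -> R -> 'rV[R]_m) (rho : R -> R) :
  measurable_vec (fun z : R * R => h z.2 z.1) ->
  (forall x i, mu.-integrable setT (fun y => (h y x 0 i)%:E)) ->
  (forall x y, h y x != 0 -> x - 5 / 4 <= y <= x - 5 / 4 + 5 / 2) ->
  measurable_fun setT rho -> (forall x, 0 <= rho x) ->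
  (\int[mu]_x (rho x * sqnorm (\row_i \int[mu]_y h y x 0 i))%:E <=
   (5 / 2)%:E * \int[mu]_y \int[mu]_x (rho x * sqnorm (h y x))%:E)%E.
Proof.
move=> mh hi hs mr r0.
have mrh : measurable_fun setT (fun z : R * R => (rho z.1 * sqnorm (h z.2 z.1))%:E).
  apply/measurable_EFinP; apply: measurable_funM; last exact: measurable_sqnorm mh.
  exact: measurableT_comp mr measurable_fst.
have rh0 (z : R * R) : (0 <= (rho z.1 * sqnorm (h z.2 z.1))%:E)%E.
  by rewrite lee_fin mulr_ge0// sqnorm_ge0.
have := @fubini_tonelli _ _ _ _ _ mu mu _ mrh rh0 => /= <-.
rewrite -ge0_integralZl//; last 2 first.
- exact: (@measurable_fun_fubini_tonelli_F _ _ _ _ _ mu _ mrh rh0).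
- by move=> x _; apply: integral_ge0 => y _; exact: (rh0 (x, y)).
apply: ge0_le_integral => //.
- by move=> x _; rewrite lee_fin mulr_ge0// sqnorm_ge0.
- apply/measurable_EFinP; apply: measurable_funM => //; apply: measurable_sqnorm => i.
  under eq_fun do rewrite mxE; exact: (measurable_Rintegral (mh i)).
- apply: emeasurable_funM => //.
  exact: (@measurable_fun_fubini_tonelli_F _ _ _ _ _ mu _ mrh rh0).
move=> x _; under eq_integral do rewrite EFinM.
rewrite ge0_integralZl//; last 3 first.
- apply/measurable_EFinP/measurable_sqnorm.
  exact: (measurable_vec_comp mh (f := fun y => (x, y)) (pair1_measurable x)).
- by move=> y _; rewrite lee_fin sqnorm_ge0.
- by rewrite lee_fin.
rewrite EFinM muleCA lee_wpmul2l ?lee_fin//.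
have L0 : 0 < 5 / 2 :> R by lra.
exact: (jensen_vec (h := h ^~ x) L0 (hi x) (hs x)).
Qed.

Variables chi0 theta : R -> R.
Hypothesis hchi0 : smooth_indicator chi0.
Hypothesis htheta : partition_generator theta.
Variable K : R.
Hypothesis theta'_le : forall x, `|derive1 theta x| <= K.

Lemma wjetB n (u U v V : R -> 'rV[R]_n) y x :
  wjet theta (fun x => u x - v x) (fun x => U x - V x) y x =
  wjet theta u U y x - wjet theta v V y x.
Proof.
rewrite /wjet opp_row_mx add_row_mx; congr row_mx; first by rewrite scalerBr.
by rewrite !scalerBr opprD addrACA.
Qed.

(** Bounded overlap of the windows: [x] is seen only from centres in an interval of length
    [5 / 2]. *)
Lemma integral_wjet_le n (u U : R -> 'rV[R]_n) x : jet u U ->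
  (\int[mu]_y (sqnorm (wjet theta u U y x))%:E <=
   ((2 * K ^+ 2 + 3) * (5 / 2) * sqnorm (row_mx (u x) (U x)))%:E)%E.
Proof.
move=> uU; pose J := `[x - 5 / 4, x + 5 / 4]%classic.
have mJ : measurable J by exact: measurable_itv.
set q := sqnorm _; pose M := 2 * K ^+ 2 + 3.
apply: (@le_trans _ _ (\int[mu]_(y in J) (M * q)%:E)%E).
  rewrite [leRHS]integral_mkcond; apply: ge0_le_integral => //.
  - by move=> y _; rewrite lee_fin sqnorm_ge0.
  - apply/measurable_EFinP/measurable_sqnorm; exact: (measurable_wjet2 htheta uU).
  - by apply: (measurable_restrictT _ _).1.
  - move=> y _; rewrite patchE; case: ifPn => [_|].
      by rewrite lee_fin /q sqnorm_row_mx; exact: (wjet_le htheta theta'_le).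
    rewrite notin_setE /J/= in_itv/= => /negP xJ.
    rewrite (wjet_far htheta) ?sqnorm0//; move: xJ; apply: contraNT.
    by rewrite -leNgt ler_norml => /andP[? ?]; apply/andP; split; lra.
rewrite integral_cst//= lebesgue_measure_itv/= lte_fin ifT; last by lra.
rewrite -EFinD -!EFinM lee_fin -/M.
by rewrite le_eqVlt; apply/orP; left; apply/eqP; field.
Qed.

Section weighted.
Variables (rho : R -> R) (E : R).
Hypothesis mrho : measurable_fun setT rho.
Hypothesis rho_ge0 : forall x, 0 <= rho x.
Hypothesis E_ge0 : 0 <= E.
Hypothesis rho_slow : forall x y, `|x - y| <= 5 / 4 -> rho x <= E * rho y.

Definition weighted_energy m (a : R -> 'rV[R]_m) : \bar R :=
  (\int[mu]_x (rho x * sqnorm (a x))%:E)%E.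

Lemma cut_jetB n (u U v V : R -> 'rV[R]_n) x : jet u U -> jet v V ->
  cut_jet chi0 theta u U x - cut_jet chi0 theta v V x =
  \row_i \int[mu]_y (cut_weight chi0 theta u U y *: wjet theta u U y x -
                    cut_weight chi0 theta v V y *: wjet theta v V y x) 0 i.
Proof.
move=> uU vV; apply/rowP => i; rewrite !mxE -RintegralB//.
- by apply: eq_Rintegral => y _; rewrite !mxE.
- exact: (cut_wjet_integrable hchi0 htheta theta'_le uU x i).
- exact: (cut_wjet_integrable hchi0 htheta theta'_le vV x i).
Qed.

(** Origin of the factors: [5 / 2] from Jensen, 81 from the truncation, one [E] for freezing the
    weight at the centre of the window and one for releasing it, and the last bracket from the
    overlap of the windows. *)
Lemma cut_jet_lipschitz n (u U v V : R -> 'rV[R]_n) : jet u U -> jet v V ->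
  (weighted_energy (fun x => cut_jet chi0 theta u U x - cut_jet chi0 theta v V x)%R <=
   (5 / 2 * (81 * E ^+ 2) * ((2 * K ^+ 2 + 3) * (5 / 2)))%:E *
   weighted_energy (fun x => row_mx (u x - v x) (U x - V x))%R)%E.
Proof.
move=> uU vV; have wW := jetB uU vV.
pose w x := u x - v x; pose W x := U x - V x.
pose h y x := cut_weight chi0 theta u U y *: wjet theta u U y x -
              cut_weight chi0 theta v V y *: wjet theta v V y x.
rewrite /weighted_energy; under eq_integral do rewrite cut_jetB//.
have mhu := measurable_cut_wjet hchi0 htheta theta'_le uU.
have mhv := measurable_cut_wjet hchi0 htheta theta'_le vV.
have mh : measurable_vec (fun z : R * R => h z.2 z.1) by exact: measurable_vecB.
have hi x i : mu.-integrable setT (fun y => (h y x 0 i)%:E).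
  have := integrableB measurableT (cut_wjet_integrable hchi0 htheta theta'_le uU x i)
    (cut_wjet_integrable hchi0 htheta theta'_le vV x i).
  by apply: eq_integrable => // y _ /=; rewrite !mxE.
have far x y : 5 / 4 < `|x - y| -> h y x = 0 :> 'rV[R]_(n + n).
  move=> xy; rewrite -[RHS](subrr (0 : 'rV[R]_(n + n))); congr (_ - _).
    exact: (cut_wjet_far chi0 htheta u U xy).
  exact: (cut_wjet_far chi0 htheta v V xy).
have hs x y : h y x != 0 -> x - 5 / 4 <= y <= x - 5 / 4 + 5 / 2.
  move=> h0; have : `|x - y| <= 5 / 4.
    by rewrite leNgt; apply: contraNN h0 => /far ->.
  by rewrite ler_norml => /andP[? ?]; apply/andP; split; lra.
apply: le_trans (weighted_jensen mh hi hs mrho rho_ge0) _.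
have mw := measurable_wjet htheta wW.
have mrw : measurable_fun setT
    (fun z : R * R => (rho z.1 * sqnorm (wjet theta w W z.2 z.1))%:E).
  apply/measurable_EFinP; apply: measurable_funM; last exact: measurable_sqnorm mw.
  exact: measurableT_comp mrho measurable_fst.
have rw0 (z : R * R) : (0 <= (rho z.1 * sqnorm (wjet theta w W z.2 z.1))%:E)%E.
  by rewrite lee_fin mulr_ge0// sqnorm_ge0.
have mrh : measurable_fun setT (fun z : R * R => (rho z.1 * sqnorm (h z.2 z.1))%:E).
  apply/measurable_EFinP; apply: measurable_funM; last exact: measurable_sqnorm mh.
  exact: measurableT_comp mrho measurable_fst.
have rh0 (z : R * R) : (0 <= (rho z.1 * sqnorm (h z.2 z.1))%:E)%E.
  by rewrite lee_fin mulr_ge0// sqnorm_ge0.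
have c0 : 0 <= 81 * E ^+ 2 by rewrite mulr_ge0// sqr_ge0.
(* For fixed [y] the weight is replaced by the constant [rho y], the unweighted truncation estimate
   is applied, and the weight is restored. By linearity ([wjetB]) the difference of the windows is
   the window of [u - v]. *)
have inner y : (\int[mu]_x (rho x * sqnorm (h y x))%:E <= (81 * E ^+ 2)%:E *
    \int[mu]_x (rho x * sqnorm (wjet theta w W y x))%:E)%E.
  have mhy : measurable_vec (h y).
    exact: (measurable_vec_comp mh (f := fun x => (x, y)) (pair2_measurable y)).
  have mwy := measurable_wjet1 htheta wW y.
  have Er : 0 <= E * rho y by rewrite mulr_ge0.
  apply: (@le_trans _ _ ((E * rho y)%:E * l2 (h y))%E).
    rewrite /l2 -ge0_integralZl//; [|exact: measurable_EFin_sqnorm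
      |by move=> x _; rewrite lee_fin sqnorm_ge0].
    apply: ge0_le_integral => //.
    - by move=> x _; exact: (rh0 (x, y)).
    - exact: (measurable_fun_pair1 y mrh).
    - by apply: emeasurable_funM => //; exact: measurable_EFin_sqnorm.
    - move=> x _; have [xy|xy] := leP `|x - y| (5 / 4); last first.
        by rewrite far// sqnorm0 mulr0 mule0.
      by rewrite -EFinM lee_fin ler_wpM2r ?sqnorm_ge0//; exact: rho_slow.
  apply: (@le_trans _ _ ((E * rho y)%:E * (81%:E * l2 (wjet theta w W y)))%E).
    rewrite lee_wpmul2l ?lee_fin//.
    have := truncation_lipschitz hchi0 (measurable_wjet1 htheta uU y)
      (measurable_wjet1 htheta vV y) (l2_wjet_lty htheta theta'_le uU y)
      (l2_wjet_lty htheta theta'_le vV y).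
    by under [X in (_ <= _ * l2 X)%E]eq_fun do rewrite -wjetB.
  rewrite muleA -EFinM /l2 -!ge0_integralZl//; last 5 first.
  - exact: (measurable_fun_pair1 y mrw).
  - by move=> x _; exact: (rw0 (x, y)).
  - exact: measurable_EFin_sqnorm.
  - by move=> x _; rewrite lee_fin sqnorm_ge0.
  - by rewrite lee_fin mulr_ge0.
  apply: ge0_le_integral => //.
  - by move=> x _; rewrite -EFinM lee_fin !mulr_ge0// sqnorm_ge0.
  - by apply: emeasurable_funM => //; exact: measurable_EFin_sqnorm.
  - by apply: emeasurable_funM => //; exact: (measurable_fun_pair1 y mrw).
  - move=> x _; have [xy|xy] := leP `|x - y| (5 / 4); last first.
      by rewrite (wjet_far htheta)// sqnorm0 mulr0 !mule0.
    rewrite -!EFinM lee_fin mulrA ler_wpM2r ?sqnorm_ge0//.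
    have : rho y <= E * rho x by apply: rho_slow; rewrite distrC.
    by move=> /(ler_wpM2l E_ge0); rewrite expr2; lra.
(* Tonelli puts the [y]-integral inside, where the overlap bound holds at each [x] and the weight is
   a mere factor. *)
have outer : (\int[mu]_y \int[mu]_x (rho x * sqnorm (wjet theta w W y x))%:E <=
    ((2 * K ^+ 2 + 3) * (5 / 2))%:E *
    \int[mu]_x (rho x * sqnorm (row_mx (w x) (W x)))%:E)%E.
  have := @fubini_tonelli _ _ _ _ _ mu mu _ mrw rw0 => /= <-.
  have M0 : 0 <= (2 * K ^+ 2 + 3) * (5 / 2).
    by have := sqr_ge0 K => K2; apply: mulr_ge0; lra.
  have [[mw0 _] [mW0 _] _] := wW.
  have mJ : measurable_fun setT (fun x => (rho x * sqnorm (row_mx (w x) (W x)))%:E).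
    apply/measurable_EFinP; apply: measurable_funM => //.
    exact: measurable_sqnorm (measurable_vec_row_mx mw0 mW0).
  have J0 x : (0 <= (rho x * sqnorm (row_mx (w x) (W x)))%:E)%E.
    by rewrite lee_fin mulr_ge0// sqnorm_ge0.
  rewrite -ge0_integralZl//; apply: ge0_le_integral => //.
  - by move=> x _; apply: integral_ge0 => y _; exact: (rw0 (x, y)).
  - exact: (@measurable_fun_fubini_tonelli_F _ _ _ _ _ mu _ mrw rw0).
  - exact: emeasurable_funM.
  - move=> x _; under eq_integral do rewrite EFinM.
    rewrite ge0_integralZl//; last 3 first.
    - exact: measurable_EFin_sqnorm (measurable_wjet2 htheta wW x).
    - by move=> y _; rewrite lee_fin sqnorm_ge0.
    - by rewrite lee_fin.
    rewrite [X in (_ <= _ * X)%E]EFinM muleCA lee_wpmul2l ?lee_fin//.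
    by rewrite -EFinM; exact: integral_wjet_le.
rewrite (EFinM (5 / 2 * _)) (EFinM (5 / 2)) -!muleA lee_wpmul2l//.
apply: le_trans (lee_wpmul2l _ outer); last by rewrite lee_fin.
have mG : measurable_fun setT
    (fun y => \int[mu]_x (rho x * sqnorm (wjet theta w W y x))%:E)%E.
  exact: (@measurable_fun_fubini_tonelli_G _ _ _ _ _ mu _ mrw rw0).
have G0 y : (0 <= \int[mu]_x (rho x * sqnorm (wjet theta w W y x))%:E)%E.
  by apply: integral_ge0 => x _; exact: (rw0 (x, y)).
rewrite -ge0_integralZl//.
apply: ge0_le_integral => //.
- by move=> y _; apply: integral_ge0 => x _; exact: (rh0 (x, y)).
- exact: (@measurable_fun_fubini_tonelli_G _ _ _ _ _ mu _ mrh rh0).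
- exact: emeasurable_funM.
Qed.

End weighted.

(* [875 = 5 / 2 * 100 * (7 / 2)]: only the [y] in an interval of length [7 / 2]
   contribute on [[a, a + 1]]. *)
Lemma cut_jet_uniform_bound n (u U : R -> 'rV[R]_n) a : jet u U ->
  (\int[mu]_(x in `[a, (a + 1)%R]) (sqnorm (cut_jet chi0 theta u U x))%:E <= 875%:E)%E.
Proof.
move=> uU; pose D := `[a, a + 1]%classic; have mD : measurable D by exact: measurable_itv.
pose rho : R -> R := \1_D.
have mrho : measurable_fun setT rho by exact: measurable_indic.
have rho0 x : 0 <= rho x by rewrite /rho indicE.
pose h y x := cut_weight chi0 theta u U y *: wjet theta u U y x.
have mh := measurable_cut_wjet hchi0 htheta theta'_le uU.
have hs x y := @cut_wjet_supp _ chi0 _ htheta _ u U x y.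
have hi x i := cut_wjet_integrable hchi0 htheta theta'_le uU x i.
have mhy y : measurable_vec (h y).
  exact: (measurable_vec_comp mh (f := fun x => (x, y)) (pair2_measurable y)).
have -> : (\int[mu]_(x in `[a, (a + 1)%R]) (sqnorm (cut_jet chi0 theta u U x))%:E)%E =
    (\int[mu]_x (rho x * sqnorm (cut_jet chi0 theta u U x))%:E)%E.
  rewrite integral_mkcond; apply: eq_integral => x _; rewrite patchE /rho indicE.
  by case: ifPn => xD; rewrite ?mul1r ?mul0r.
apply: le_trans (weighted_jensen mh hi hs mrho rho0) _.
pose J := `[a - 5 / 4, a + 1 + 5 / 4]%classic; have mJ : measurable J by exact: measurable_itv.
have mrh : measurable_fun setT (fun z : R * R => (rho z.1 * sqnorm (h z.2 z.1))%:E).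
  apply/measurable_EFinP; apply: measurable_funM; last exact: measurable_sqnorm mh.
  exact: measurableT_comp mrho measurable_fst.
have rh0 (z : R * R) : (0 <= (rho z.1 * sqnorm (h z.2 z.1))%:E)%E.
  by rewrite lee_fin mulr_ge0// sqnorm_ge0.
apply: (@le_trans _ _ ((5 / 2)%:E * \int[mu]_(y in J) (cst 100%:E y))%E).
  rewrite lee_wpmul2l// [leRHS]integral_mkcond; apply: ge0_le_integral => //.
  - by move=> y _; apply: integral_ge0 => x _; exact: (rh0 (x, y)).
  - exact: (@measurable_fun_fubini_tonelli_G _ _ _ _ _ mu _ mrh rh0).
  - by apply: (measurable_restrictT _ _).1.
  - move=> y _; rewrite patchE; case: ifPn => [_|yJ].
      apply: le_trans (truncation_bounded hchi0 (measurable_wjet1 htheta uU y)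
        (l2_wjet_lty htheta theta'_le uU y)).
      apply: ge0_le_integral => //.
      + by move=> x _; exact: (rh0 (x, y)).
      + exact: (measurable_fun_pair1 y mrh).
      + exact: measurable_EFin_sqnorm (mhy y).
      + move=> x _; rewrite lee_fin ler_piMl ?sqnorm_ge0//.
        by rewrite /rho indicE; case: (x \in D).
    (* For [y] outside [J], every point of [D] is farther than [5 / 4] from [y]. *)
    rewrite integral0_eq// => x _; rewrite /rho indicE.
    have [|xD] := boolP (x \in D); last by rewrite mul0r.
    rewrite inE /D/= in_itv/= mul1r => /andP[ax xa].
    rewrite (wjet_far htheta) ?scaler0 ?sqnorm0//.
    move: yJ; rewrite notin_setE /J/= in_itv/= => /negP; apply: contraNT.
    by rewrite -leNgt ler_norml => /andP[? ?]; apply/andP; split; lra.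
rewrite integral_cst//= lebesgue_measure_itv/= lte_fin ifT; last by lra.
by rewrite -EFinD -!EFinM lee_fin; lra.
Qed.

End estimates.

(** * The total mass of theta *)

Section unit_mass.
Context {R : realType}.
Local Notation mu := (@lebesgue_measure R).
Variable theta : R -> R.
Hypothesis htheta : partition_generator theta.

(** For [x] in [[0, 1]] and [|j| >= 2], the point [x - j] is at most [-1] or at least 2, hence
    outside the support. *)
Lemma theta_sum3 (x : R) : 0 <= x <= 1 -> theta (x + 1) + theta x + theta (x - 1) = 1.
Proof.
move=> /andP[x0 x1]; have [_ /(_ x) sum1 _ _ _] := htheta.
pose A := [set` [:: (-1)%Z; 0%Z; 1%Z]].
have tge (j : int) : setT j -> (0 <= (theta (x - j%:~R))%:E)%E.
  by move=> _; rewrite lee_fin theta_ge0.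
apply/EFin_inj; rewrite -sum1 (esumID A)// setTI [X in (_ + X)%E]esum1 ?adde0; last first.
  move=> j [_ /negP]; rewrite !inE !negb_or => /and3P[j1 j2 j3].
  congr EFin; apply/eqP; apply/negPn/negP => /(theta_supp htheta)/andP[].
  have : (2 <= j)%R \/ (j <= -2)%R by lia.
  rewrite -2!(ler_int R) mulrNz -[2%:~R]/(2 : R).
  set r : R := j%:~R => -[j2'|j2'].
    lra.
  lra.
rewrite esum_fset//=; last by move=> i _; exact: tge.
  rewrite -fsbig_seq// !big_cons big_nil.
  transitivity (theta (x - - 1) + (theta (x - 0) + (theta (x - 1) + 0)))%:E => //.
  by congr EFin; rewrite opprK subr0 addr0 addrA.
exact: finite_seq.
Qed.

Lemma ge0_integralD3 (D : set R) (f g h : R -> \bar R) : measurable D ->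
  measurable_fun D f -> measurable_fun D g -> measurable_fun D h ->
  (forall x, 0 <= f x)%E -> (forall x, 0 <= g x)%E -> (forall x, 0 <= h x)%E ->
  (\int[mu]_(x in D) (f x + g x + h x) =
   \int[mu]_(x in D) f x + \int[mu]_(x in D) g x + \int[mu]_(x in D) h x)%E.
Proof.
move=> mD mf mg mh f0 g0 h0; rewrite ge0_integralD//; last 2 first.
- by move=> x _; rewrite adde_ge0.
- exact: emeasurable_funD.
by rewrite ge0_integralD.
Qed.

(** The support is covered by the unit intervals starting at [-1], 0 and 1. Shifting all three to
    [[0, 1[] stacks up the partition of unity, whose integral there is 1. *)
Lemma theta_integral : (\int[mu]_x (theta x)%:E = 1)%E.
Proof.
have /test_functionP[st _] := theta_test htheta.
have mt := smooth_measurable st.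
have mtE (D : set R) : measurable_fun D (fun x => (theta x)%:E).
  by apply/measurable_EFinP; exact: measurable_funTS.
have t0 x : (0 <= (theta x)%:E)%E by rewrite lee_fin theta_ge0.
pose I (a : R) := `[a, a + 1[%classic.
have mI a : measurable (I a) by exact: measurable_itv.
have shift a : (\int[mu]_(x in I a) (theta x)%:E = \int[mu]_(x in I 0%R) (theta (x + a)%R)%:E)%E.
  rewrite -(@integral_shift _ a _ (I a))//; congr (integral _ _ _).
  by apply/seteqP; split => x; rewrite /I/= !in_itv/= => /andP[? ?]; apply/andP; split; lra.
transitivity (\int[mu]_x (((fun x => (theta x)%:E) \_ (I (-1)%R) x +
    ((fun x => (theta x)%:E) \_ (I 0%R)) x + ((fun x => (theta x)%:E) \_ (I 1%R)) x)))%E.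
  apply: eq_integral => x _; rewrite !patchE /I !mem_setE !in_itv/=.
  have [h1|h1] := boolP (-1 <= x < -1 + 1).
    by rewrite !ifF ?adde0//; apply/negbTE; lra.
  have [h2|h2] := boolP (0 <= x < 0 + 1).
    by rewrite ifF ?adde0 ?add0e//; apply/negbTE; lra.
  case: ifPn => h3; first by rewrite !add0e.
  rewrite (_ : theta x = 0)// ?adde0//; apply/eqP; apply: contraNT h3.
  by move=> /(theta_supp htheta)/andP[? ?]; apply/andP; split; lra.
have mp a : measurable_fun setT ((fun x => (theta x)%:E) \_ (I a))%E.
  exact: (measurable_restrictT _ _).1.
have p0 a x : (0 <= ((fun x => (theta x)%:E) \_ (I a)) x)%E by rewrite patchE; case: ifP.
rewrite (ge0_integralD3 _ (mp _) (mp _) (mp _) (p0 _) (p0 _) (p0 _))//.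
rewrite -!integral_mkcond (shift (-1)) (shift 0) (shift 1).
have ms a (D : set R) : measurable_fun D (fun x => (theta (x + a)%R)%:E).
  apply/measurable_EFinP/measurable_funTS; apply: measurableT_comp mt _.
  exact: measurable_funD.
rewrite -(ge0_integralD3 _ (ms _ _) (ms _ _) (ms _ _))//;
  [|by move=> x; rewrite lee_fin theta_ge0..].
transitivity (\int[mu]_(x in I 0%R) cst 1%E x)%E.
  apply: eq_integral => x; rewrite inE /I /= in_itv/= => /andP[x0 x1].
  rewrite -!EFinD addr0; congr EFin; rewrite -[RHS](@theta_sum3 x).
    by ring.
  by apply/andP; split; lra.
rewrite integral_cst; last exact: mI.
rewrite /= /I lebesgue_measure_itv/= lte_fin ifT; last by lra.
by rewrite mul1e -EFinD; congr EFin; lra.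
Qed.

End unit_mass.

(** * Translations, null sets and small functions *)

Section cutoff_symmetries.
Context {R : realType}.
Local Notation mu := (@lebesgue_measure R).
Variables chi0 theta : R -> R.
Hypothesis hchi0 : smooth_indicator chi0.
Hypothesis htheta : partition_generator theta.
Variable K : R.
Hypothesis theta'_le : forall x, `|derive1 theta x| <= K.

Lemma l2_shift m (a : R -> 'rV[R]_m) c : measurable_vec a -> l2 (fun x => a (x + c)) = l2 a.
Proof.
move=> ma; have := @integral_shift R c (fun x => (sqnorm (a x))%:E) setT measurableT
  (measurable_EFin_sqnorm (D := setT) ma).
by rewrite (_ : [set x | [set: R] (x + c)] = setT)//; apply/seteqP; split.
Qed.

Lemma l2_ae m (a b : R -> 'rV[R]_m) : measurable_vec a -> measurable_vec b ->
  {ae mu, forall x, a x = b x} -> l2 a = l2 b.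
Proof.
move=> ma mb ab; apply: ae_eq_integral => //; [exact: measurable_EFin_sqnorm..|].
by apply: ae_sub ab => x abx _; rewrite abx.
Qed.

Lemma eq_cut_weight n (u U v V : R -> 'rV[R]_n) y z :
  l2 (wjet theta u U y) = l2 (wjet theta v V z) ->
  cut_weight chi0 theta u U y = cut_weight chi0 theta v V z.
Proof. by rewrite /cut_weight /l2norm => ->. Qed.

Lemma cutoff_integrandE n (u U : R -> 'rV[R]_n) x y i : jet u U ->
  cutoff_integrand chi0 theta u x y 0 i =
  cut_weight chi0 theta u U y * (theta (x - y) * u x 0 i).
Proof.
move=> uU; transitivity (chi0 (fine (normH1 (window theta u y))) * theta (x - y) * u x 0 i).
  by rewrite /cutoff_integrand [LHS]mxE.
by rewrite -mulrA; congr (_ * _); exact: (cut_weightE chi0 htheta uU).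
Qed.

Lemma cutoff_entry n (u U : R -> 'rV[R]_n) x i : jet u U ->
  cutoff chi0 theta u x 0 i =
  \int[mu]_y (cut_weight chi0 theta u U y * (theta (x - y) * u x 0 i)).
Proof.
by move=> uU; rewrite [LHS]mxE; apply: eq_Rintegral => y _; exact: cutoff_integrandE.
Qed.

Lemma jet_translate n a (u U : R -> 'rV[R]_n) : jet u U ->
  jet (translate a u) (translate a U).
Proof. exact: jet_shift. Qed.

Lemma wjet_translate n a (u U : R -> 'rV[R]_n) y :
  wjet theta (translate a u) (translate a U) y =
  fun x => wjet theta u U (y - a) (x + - a).
Proof.
apply/funext => x; rewrite /wjet /translate.
by have -> : x - a - (y - a) = x - y by ring.
Qed.

Lemma cut_weight_translate n a (u U : R -> 'rV[R]_n) y : jet u U ->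
  cut_weight chi0 theta (translate a u) (translate a U) y =
  cut_weight chi0 theta u U (y - a).
Proof.
move=> uU; apply: eq_cut_weight; have -> := wjet_translate a u U y.
exact: l2_shift (measurable_wjet1 htheta uU (y - a)).
Qed.

(** The window of the translate at [y] is the translated window at [y - a], with the same norm;
    substituting in [y] then gives equality at every point. *)
Lemma cutoff_translate n a (u U : R -> 'rV[R]_n) : jet u U ->
  cutoff chi0 theta (translate a u) = translate a (cutoff chi0 theta u).
Proof.
move=> uU; apply/funext => x; apply/rowP => i.
rewrite (cutoff_entry x i (jet_translate a uU)) [RHS](cutoff_entry (x - a) i uU).
have mw := measurable_cut_weight hchi0 htheta theta'_le uU.
have /test_functionP[st _] := theta_test htheta.
have mt : measurable_fun setT (fun y : R => theta (x - a - y)).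
  by apply: measurableT_comp; [exact: smooth_measurable|exact: measurable_funB].
rewrite -[RHS](Rintegral_shift (- a)); last first.
  exact: measurable_funM mw (measurable_funM mt (measurable_cst _)).
apply: eq_Rintegral => y _; rewrite (cut_weight_translate a y uU) /translate.
by have -> : x - a - (y + - a) = x - y by ring.
Qed.

(** A common [U] serves as weak derivative of both functions, so the weights agree for every [y],
    and the cut-offs agree wherever [u] and [v] do. *)
Lemma cutoff_ae n (u v U : R -> 'rV[R]_n) : jet u U -> L2loc v ->
  {ae mu, forall x, u x = v x} ->
  {ae mu, forall x, cutoff chi0 theta u x = cutoff chi0 theta v x}.
Proof.
move=> uU lv uv; have vU := jet_ae uU lv uv.
have W y : cut_weight chi0 theta u U y = cut_weight chi0 theta v U y.
  apply: eq_cut_weight; apply: l2_ae.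
  - exact: (measurable_wjet1 htheta uU y).
  - exact: (measurable_wjet1 htheta vU y).
  - by apply: ae_sub uv => x uvx; rewrite /wjet uvx.
apply: ae_sub uv => x uvx; apply/rowP => i.
rewrite (cutoff_entry x i uU) (cutoff_entry x i vU).
by apply: eq_Rintegral => y _; rewrite uvx W.
Qed.

Lemma cutoff_integrable n (u U : R -> 'rV[R]_n) x i : jet u U ->
  mu.-integrable setT (fun y => (cutoff_integrand chi0 theta u x y 0 i)%:E).
Proof.
move=> uU.
have := cut_wjet_integrable hchi0 htheta theta'_le uU x (lshift n i).
apply: eq_integrable => // y _; congr EFin.
rewrite (cutoff_integrandE x y i uU) [LHS]mxE; congr (_ * _).
by rewrite /wjet row_mxEl mxE.
Qed.

(** All weights equal 1, and the integral of [theta (x - y)] over [y] is 1 by reflection. The strict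
    bound is needed as [chi0] is known to be 1 only strictly inside [[-1, 1]]. *)
Lemma cutoff_id n (u U : R -> 'rV[R]_n) : jet u U ->
  (forall y, (l2 (wjet theta u U y) < 1)%E) -> cutoff chi0 theta u = u.
Proof.
move=> uU small; have /test_functionP[st _] := theta_test htheta.
have mt := smooth_measurable st.
have w1 y : cut_weight chi0 theta u U y = 1.
  have [_ _ c1 _] := hchi0; apply: c1; rewrite ger0_norm ?l2norm_ge0//.
  have fin := l2_wjet_lty htheta theta'_le uU y.
  rewrite -(@ltr_sqr _ _ 1) ?nnegrE ?l2norm_ge0// expr1n -lte_fin.
  by rewrite -(l2E fin); exact: small.
have th x : (\int[mu]_y (theta (x - y))%:E = 1)%E.
  rewrite -[RHS](theta_integral htheta).
  by apply: (integral_reflect x (f := fun z => (theta z)%:E)); exact/measurable_EFinP.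
apply/funext => x; apply/rowP => i; rewrite (cutoff_entry x i uU).
under eq_Rintegral do rewrite w1 mul1r.
rewrite RintegralZr//; first by rewrite /Rintegral th mul1r.
apply/integrableP; split.
  by apply/measurable_EFinP; apply: (measurableT_comp mt); exact: measurable_funB.
rewrite (_ : (\int[mu]_y _)%E = 1%E) ?ltry// -(th x).
by apply: eq_integral => y _; rewrite gee0_abs// lee_fin theta_ge0.
Qed.
End cutoff_symmetries.

(** * Energies on unit intervals and on windows *)

Section unit_energy_bounds.
Context {R : realType}.
Local Notation mu := (@lebesgue_measure R).
Variables chi0 theta : R -> R.
Hypothesis hchi0 : smooth_indicator chi0.
Hypothesis htheta : partition_generator theta.
Variable K : R.
Hypothesis theta'_le : forall x, `|derive1 theta x| <= K.

Lemma unit_energy n (u U : R -> 'rV[R]_n) y : jet u U ->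
  H1norm (fun=> 1) [set x | 0 <= x <= 1] (translate y u) =
  sqrte (\int[mu]_(x in `[(- y)%R, (- y + 1)%R]) (sqnorm (u x) + sqnorm (U x))%:E)%E.
Proof.
move=> uU; rewrite (H1norm_jet htheta (jet_translate y uU))//; last first.
  rewrite (_ : [set x | _] = `[0, 1]%classic); first exact: measurable_itv.
  by apply/seteqP; split => x; rewrite /= in_itv.
congr sqrte; rewrite -[RHS](@integral_shift _ (- y) _ `[- y, - y + 1]%classic)//.
  rewrite (_ : [set x | `[- y, - y + 1]%classic (x + - y)] = [set x | 0 <= x <= 1]).
    by apply: eq_integral => x _; rewrite mul1r.
  by apply/seteqP; split => x; rewrite /= in_itv/= => /andP[? ?]; apply/andP; split; lra.
have [[mu' _] [mU _] _] := uU.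
by apply/measurable_EFinP/measurable_funTS; apply: measurable_funD; exact: measurable_sqnorm.
Qed.

(** The window lives on [[y - 5 / 4, y + 5 / 4]], which is covered by the three unit intervals
    starting at [y - 3 / 2], [y - 1 / 2] and [y + 1 / 2]. *)
Lemma wjet_small n (u U : R -> 'rV[R]_n) (e : R) y : jet u U ->
  (forall a, (\int[mu]_(x in `[a, (a + 1)%R]) (sqnorm (u x) + sqnorm (U x))%:E <= e%:E)%E) ->
  (l2 (wjet theta u U y) <= ((2 * K ^+ 2 + 3) * (e + e + e))%:E)%E.
Proof.
move=> uU ue; pose q x := sqnorm (u x) + sqnorm (U x).
have q0 x : 0 <= q x by rewrite addr_ge0// sqnorm_ge0.
have [[mu' _] [mU _] _] := uU.
have mq : measurable_fun setT (EFin \o q).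
  by apply/measurable_EFinP; apply: measurable_funD; exact: measurable_sqnorm.
pose I (a : R) := `[a, a + 1]%classic.
have mI a : measurable (I a) by exact: measurable_itv.
pose r a := (EFin \o q) \_ (I a).
have mr a : measurable_fun setT (r a).
  by apply: (measurable_restrictT _ _).1 => //; exact: measurable_funTS.
have r0 a x : (0 <= r a x)%E by rewrite /r patchE; case: ifP => // _; rewrite lee_fin.
have M0 : 0 <= 2 * K ^+ 2 + 3 by have := sqr_ge0 K; lra.
have mS : measurable_fun setT
    (fun x => r (y - 3 / 2)%R x + r (y - 1 / 2)%R x + r (y + 1 / 2)%R x)%E.
  exact: emeasurable_funD (emeasurable_funD (mr _) (mr _)) (mr _).
have S0 x : (0 <= r (y - 3 / 2)%R x + r (y - 1 / 2)%R x + r (y + 1 / 2)%R x)%E.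
  by rewrite !adde_ge0.
apply: (@le_trans _ _ ((2 * K ^+ 2 + 3)%:E *
    \int[mu]_x (r (y - 3 / 2)%R x + r (y - 1 / 2)%R x + r (y + 1 / 2)%R x))%E).
  rewrite -ge0_integralZl//.
  apply: ge0_le_integral => //.
  - by move=> x _; rewrite lee_fin sqnorm_ge0.
  - exact: measurable_EFin_sqnorm (measurable_wjet1 htheta uU y).
  - exact: emeasurable_funM.
  - move=> x _; have [xy|xy] := leP `|x - y| (5 / 4); last first.
      by rewrite (wjet_far htheta)// sqnorm0 mule_ge0 ?lee_fin// !adde_ge0.
    apply: (@le_trans _ _ ((2 * K ^+ 2 + 3)%:E * (q x)%:E)%E).
      by rewrite -EFinM lee_fin; exact: (wjet_le htheta theta'_le).
    rewrite lee_wpmul2l ?lee_fin//; move: xy; rewrite ler_norml => /andP[xy1 xy2].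
    have rI a : x \in I a -> r a x = (q x)%:E by rewrite /r patchE => ->.
    have [x1|x1] := leP x (y - 1 / 2).
      rewrite (rI (y - 3 / 2)%R); first by rewrite -addeA leeDl// adde_ge0.
      by rewrite inE /I/= in_itv/=; apply/andP; split; lra.
    have [x2|x2] := leP x (y + 1 / 2).
      rewrite (rI (y - 1 / 2)%R); first by rewrite addeAC leeDr// adde_ge0.
      by rewrite inE /I/= in_itv/=; apply/andP; split; lra.
    rewrite (rI (y + 1 / 2)%R); first by rewrite leeDr// adde_ge0.
    by rewrite inE /I/= in_itv/=; apply/andP; split; lra.
rewrite (ge0_integralD3 _ (mr _) (mr _) (mr _) (r0 _) (r0 _) (r0 _))//.
rewrite EFinM lee_wpmul2l ?lee_fin// !EFinD /r -!integral_mkcond.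
by apply: leeD; [apply: leeD|]; exact: ue.
Qed.

End unit_energy_bounds.

(** * The scaled cut-off *)

Section scaled_cutoff.
Context {R : realType}.
Local Notation mu := (@lebesgue_measure R).
Variables chi0 theta : R -> R.
Hypothesis hchi0 : smooth_indicator chi0.
Hypothesis htheta : partition_generator theta.
Variable K : R.
Hypothesis theta'_le : forall x, `|derive1 theta x| <= K.
Variable eta : R.
Hypothesis eta_gt0 : 0 < eta.

Let rho (x : R) := expR (- (2 * eta * `|x|)).
Let E := expR (2 * eta * (5 / 4)).

Lemma rho_gt0 x : 0 < rho x.
Proof. exact: expR_gt0. Qed.

Lemma measurable_rho : measurable_fun setT rho.
Proof.
apply: (measurableT_comp (@measurable_expR R)); apply: measurableT_comp => //.
apply: measurable_funM => //; exact: normr_measurable.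
Qed.

(** Reverse triangle inequality in the exponent. Taking [c = 5 / 4] yields the slow variation with
    constant [E]; taking [c = |a|] handles translation by [a]. *)
Lemma rho_translate_le c x y : `|x - y| <= c -> rho x <= expR (2 * eta * c) * rho y.
Proof.
move=> xy; rewrite /rho -expRD ler_expR -mulrN -mulrN -mulrDr ler_pM2l ?mulr_gt0//.
by have := lerB_dist y x; rewrite distrC; lra.
Qed.

Lemma normH1w_jet n (u U : R -> 'rV[R]_n) : jet u U ->
  normH1w eta u = sqrte (weighted_energy rho (fun x => row_mx (u x) (U x))).
Proof.
move=> uU; rewrite /normH1w (H1norm_jet htheta uU measurableT measurable_rho).
by congr sqrte; apply: eq_integral => x _; rewrite sqnorm_row_mx.
Qed.

Lemma weighted_energyZ m c (a : R -> 'rV[R]_m) : measurable_vec a ->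
  weighted_energy rho (fun x => c *: a x) = ((c ^+ 2)%:E * weighted_energy rho a)%E.
Proof.
move=> ma; rewrite /weighted_energy -ge0_integralZl//.
- by apply: eq_integral => x _; rewrite sqnormZ -EFinM; congr EFin; ring.
- apply/measurable_EFinP; apply: measurable_funM; first exact: measurable_rho.
  exact: measurable_sqnorm.
- by move=> x _; rewrite lee_fin mulr_ge0 ?sqnorm_ge0// ltW// rho_gt0.
- by rewrite lee_fin sqr_ge0.
Qed.

Lemma weighted_energy_ge0 m (a : R -> 'rV[R]_m) : (0 <= weighted_energy rho a)%E.
Proof.
by apply: integral_ge0 => x _; rewrite lee_fin mulr_ge0 ?sqnorm_ge0// ltW// rho_gt0.
Qed.

Lemma jet_measurable n (u U : R -> 'rV[R]_n) : jet u U ->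
  measurable_vec (fun x => row_mx (u x) (U x)).
Proof. by move=> [[mu' _] [mU _] _]; exact: measurable_vec_row_mx. Qed.

Lemma cutoff_eps_jet n (u U : R -> 'rV[R]_n) eps : jet u U ->
  jet (cutoff_eps chi0 theta eps u) (fun x => eps *:
    rsubmx (cut_jet chi0 theta (fun x => eps^-1 *: u x) (fun x => eps^-1 *: U x) x)).
Proof.
by move=> uU; exact: jetZ (cutoff_jet hchi0 htheta theta'_le (jetZ eps^-1 uU)).
Qed.

Lemma cutoff_epsE n (u U : R -> 'rV[R]_n) eps x : jet u U ->
  cutoff_eps chi0 theta eps u x = eps *:
    lsubmx (cut_jet chi0 theta (fun x => eps^-1 *: u x) (fun x => eps^-1 *: U x) x).
Proof. by move=> uU; rewrite /cutoff_eps (cutoffE chi0 htheta (jetZ eps^-1 uU)). Qed.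

Definition lipschitz_sq : R := 5 / 2 * (81 * E ^+ 2) * ((2 * K ^+ 2 + 3) * (5 / 2)).

Lemma lipschitz_sq_gt0 : 0 < lipschitz_sq.
Proof.
have E0 : 0 < E ^+ 2 by rewrite exprn_gt0// expR_gt0.
have := sqr_ge0 K => K2; rewrite /lipschitz_sq.
by apply: mulr_gt0; apply: mulr_gt0; lra.
Qed.

(** [cut_jet_lipschitz] for [u / eps] and [v / eps]: both energies pick up the same factor
    [eps ^+ 2], so the constant is free of [eps]. Energies are squares, hence the root of
    [lipschitz_sq]. *)
Lemma cutoff_eps_lipschitz n (u U v V : R -> 'rV[R]_n) eps : 0 < eps ->
  jet u U -> jet v V ->
  (normH1w eta (fun x => cutoff_eps chi0 theta eps u x - cutoff_eps chi0 theta eps v x)%R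
   <= (Num.sqrt lipschitz_sq)%:E * normH1w eta (fun x => u x - v x)%R)%E.
Proof.
move=> eps0 uU vV; have uU' := jetZ eps^-1 uU; have vV' := jetZ eps^-1 vV.
have cu := cutoff_eps_jet eps uU; have cv := cutoff_eps_jet eps vV.
rewrite (normH1w_jet (jetB cu cv)) (normH1w_jet (jetB uU vV)).
set cJu := cut_jet chi0 theta _ (fun x => eps^-1 *: U x).
set cJv := cut_jet chi0 theta _ (fun x => eps^-1 *: V x).
have mcu : measurable_vec cJu by exact: (measurable_cut_jet hchi0 htheta theta'_le uU').
have mcv : measurable_vec cJv by exact: (measurable_cut_jet hchi0 htheta theta'_le vV').
have -> : (fun x => row_mx (cutoff_eps chi0 theta eps u x - cutoff_eps chi0 theta eps v x)
    (eps *: rsubmx (cJu x) - eps *: rsubmx (cJv x))) = fun x => eps *: (cJu x - cJv x).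
  apply/funext => x; rewrite (cutoff_epsE eps x uU) (cutoff_epsE eps x vV).
  by rewrite -/cJu -/cJv -!scalerBr -scale_row_mx -!linearB hsubmxK.
rewrite (weighted_energyZ _ (measurable_vecB mcu mcv)).
have -> : (Num.sqrt lipschitz_sq)%:E = sqrte lipschitz_sq%:E by [].
rewrite -sqrteM; last by rewrite lee_fin ltW// lipschitz_sq_gt0.
rewrite lee_sqrt; last first.
  by rewrite mule_ge0 ?weighted_energy_ge0// lee_fin ltW// lipschitz_sq_gt0.
have := cut_jet_lipschitz hchi0 htheta theta'_le measurable_rho
  (fun x => ltW (rho_gt0 x)) (ltW (expR_gt0 _)) (@rho_translate_le (5 / 4)) uU' vV'.
rewrite -/E -/lipschitz_sq -/cJu -/cJv => h.
have -> : weighted_energy rho (fun x => row_mx (u x - v x) (U x - V x)) =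
    ((eps ^+ 2)%:E * weighted_energy rho (fun x => row_mx
      (eps^-1 *: u x - eps^-1 *: v x) (eps^-1 *: U x - eps^-1 *: V x)))%E.
  rewrite -(weighted_energyZ eps (jet_measurable (jetB uU' vV'))).
  congr weighted_energy; apply/funext => x.
  by rewrite -!scalerBr -scale_row_mx scalerA mulfV ?scale1r// gt_eqF.
rewrite muleCA lee_wpmul2l//.
by rewrite lee_fin sqr_ge0.
Qed.

Lemma cutoff0 n : cutoff chi0 theta (fun _ => 0 : 'rV[R]_n) = fun _ => 0.
Proof.
apply/funext => x; apply/rowP => i; rewrite (cutoff_entry chi0 htheta x i (jet0 n)) mxE.
by under eq_Rintegral do rewrite !mulr0; rewrite /Rintegral integral0.
Qed.

(** The Lipschitz estimate compared with the zero function, which the cut-off fixes. *)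
Lemma cutoff_eps_H1w n (u U : R -> 'rV[R]_n) eps : 0 < eps -> jet u U ->
  (normH1w eta u < +oo)%E -> (normH1w eta (cutoff_eps chi0 theta eps u) < +oo)%E.
Proof.
move=> eps0 uU fu; have := cutoff_eps_lipschitz eps0 uU (jet0 n).
have -> : cutoff_eps chi0 theta eps (fun _ : R => 0 : 'rV[R]_n) = fun _ => 0.
  apply/funext => x; rewrite /cutoff_eps (_ : (fun=> _) = fun _ => 0 : 'rV[R]_n).
    by rewrite cutoff0 scaler0.
  by apply/funext => z; rewrite scaler0.
under eq_fun do rewrite subr0.
under [X in (_ <= _ * normH1w _ X)%E -> _]eq_fun do rewrite subr0.
move=> h; apply: le_lt_trans h _.
by rewrite lte_mul_pinfty// lee_fin sqrtr_ge0.
Qed.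

Lemma sqrte_lty (x : \bar R) : (0 <= x)%E -> (sqrte x < +oo)%E = (x < +oo)%E.
Proof. by move=> x0; rewrite -!ge0_fin_numE ?sqrte_ge0// sqrte_fin_num. Qed.

Lemma normH1w_translate n (u U : R -> 'rV[R]_n) a : jet u U ->
  (normH1w eta u < +oo)%E -> (normH1w eta (translate a u) < +oo)%E.
Proof.
move=> uU; rewrite (normH1w_jet uU) (normH1w_jet (jet_translate a uU)).
set J := fun x => row_mx (u x) (U x).
have mJ : measurable_vec J by exact: jet_measurable.
have J0 := weighted_energy_ge0 J.
rewrite !sqrte_lty ?weighted_energy_ge0// => fJ.
have mI : measurable_fun setT (fun x => (rho x * sqnorm (J x))%:E).
  apply/measurable_EFinP; apply: measurable_funM; first exact: measurable_rho.
  exact: measurable_sqnorm.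
have I0 x : (0 <= (rho x * sqnorm (J x))%:E)%E.
  by rewrite lee_fin mulr_ge0 ?sqnorm_ge0// ltW// rho_gt0.
have ms : measurable_fun [set: R] (fun x : R => x + - a) by exact: measurable_funD.
apply: (@le_lt_trans _ _ ((expR (2 * eta * `|a|))%:E *
    \int[mu]_x (rho (x + - a)%R * sqnorm (J (x + - a)%R))%:E)%E).
  rewrite -ge0_integralZl//; last first.
    by apply: (measurableT_comp mI); exact: ms.
  apply: ge0_le_integral => //.
  - by move=> x _; rewrite lee_fin mulr_ge0 ?sqnorm_ge0// ltW// rho_gt0.
  - apply/measurable_EFinP; apply: measurable_funM; first exact: measurable_rho.
    exact: measurable_sqnorm (jet_measurable (jet_translate a uU)).
  - by apply: emeasurable_funM => //; apply: (measurableT_comp mI); exact: ms.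
  - move=> x _; rewrite -EFinM lee_fin mulrA ler_wpM2r ?sqnorm_ge0//.
    by apply: rho_translate_le; rewrite opprD opprK addNKr.
rewrite lte_mul_pinfty// ?lee_fin ?expR_ge0//.
have := @integral_shift _ (- a) _ setT measurableT mI.
rewrite (_ : [set x | [set: R] (x + - a)] = setT); last by apply/seteqP; split.
by move=> ->; exact: fJ.
Qed.

Lemma cutoff_eps_translate n (u U : R -> 'rV[R]_n) a eps : jet u U ->
  cutoff_eps chi0 theta eps (translate a u) = translate a (cutoff_eps chi0 theta eps u).
Proof.
move=> uU; apply/funext => x; rewrite /cutoff_eps /translate; congr (_ *: _).
have h := cutoff_translate hchi0 htheta theta'_le a (jetZ eps^-1 uU).
exact: (congr1 (fun f => f x) h).
Qed.

Lemma cutoff_eps_H1u n (u U : R -> 'rV[R]_n) eps : 0 < eps -> jet u U ->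
  (normH1u (cutoff_eps chi0 theta eps u) <= (Num.sqrt 875 * eps)%:E)%E.
Proof.
move=> eps0 uU; apply: ge_ereal_sup => _ [y _ <-].
have uU' := jetZ eps^-1 uU.
rewrite (unit_energy htheta y (cutoff_eps_jet eps uU)).
have -> : (Num.sqrt 875 * eps)%:E = sqrte (eps ^+ 2 * 875)%:E.
  by rewrite /= sqrtrM ?sqr_ge0// sqrtr_sqr gtr0_norm// mulrC.
rewrite lee_sqrt; last by rewrite lee_fin; have := sqr_ge0 eps; lra.
have := cut_jet_uniform_bound hchi0 htheta theta'_le (- y) uU'.
set cJ := cut_jet _ _ _ _ => h.
have mc : measurable_vec cJ by exact: (measurable_cut_jet hchi0 htheta theta'_le uU').
apply: (@le_trans _ _ ((eps ^+ 2)%:E *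
    \int[mu]_(x in `[(- y)%R, (- y + 1)%R]) (sqnorm (cJ x))%:E)%E).
  rewrite -ge0_integralZl//; last 3 first.
  - exact: measurable_EFin_sqnorm.
  - by move=> x _; rewrite lee_fin sqnorm_ge0.
  - by rewrite lee_fin sqr_ge0.
  rewrite le_eqVlt; apply/orP; left; apply/eqP; apply: eq_integral => x _.
  rewrite (cutoff_epsE eps x uU) -/cJ !sqnormZ -EFinM -mulrDr -sqnorm_row_mx.
  by rewrite hsubmxK.
rewrite (EFinM (eps ^+ 2) 875); apply: lee_wpmul2l h.
by rewrite lee_fin sqr_ge0.
Qed.

(** On each unit interval [u / eps] has energy at most [c ^+ 2]; a window meets three of them, and
    the condition on [c] is what [wjet_small] needs to bring its energy below 1. *)
Lemma cutoff_eps_id n (u U : R -> 'rV[R]_n) eps c : 0 < eps -> jet u U -> 0 < c ->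
  (2 * K ^+ 2 + 3) * (c ^+ 2 + c ^+ 2 + c ^+ 2) < 1 ->
  (normH1u u < (c * eps)%:E)%E -> cutoff_eps chi0 theta eps u = u.
Proof.
move=> eps0 uU c0 c1 uc; have uU' := jetZ eps^-1 uU.
have ue a : (\int[mu]_(x in `[a, (a + 1)%R])
    (sqnorm (eps^-1 *: u x) + sqnorm (eps^-1 *: U x))%:E <= (c ^+ 2)%:E)%E.
  have : (H1norm (fun=> 1%R) [set x | (0 <= x <= 1)%R] (translate (- a)%R u)
      <= (c * eps)%:E)%E.
    by apply: le_trans (ltW uc); apply: ereal_sup_ubound; exists (- a).
  rewrite (unit_energy htheta (- a) uU) opprK.
  have -> : (c * eps)%:E = sqrte ((c * eps) ^+ 2)%:E.
    by rewrite /= sqrtr_sqr ger0_norm// mulr_ge0// ltW.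
  rewrite lee_sqrt ?lee_fin ?sqr_ge0// => h.
  have [[mu' _] [mU _] _] := uU.
  have -> : (\int[mu]_(x in `[a, (a + 1)%R])
      (sqnorm (eps^-1 *: u x) + sqnorm (eps^-1 *: U x))%:E =
      (eps^-1 ^+ 2)%:E * \int[mu]_(x in `[a, (a + 1)%R]) (sqnorm (u x) + sqnorm (U x))%:E)%E.
    rewrite -ge0_integralZl//.
    - by apply: eq_integral => x _; rewrite !sqnormZ -EFinM mulrDr.
    - by apply/measurable_EFinP/measurable_funTS; apply: measurable_funD; exact: measurable_sqnorm.
    - by move=> x _; rewrite lee_fin addr_ge0// sqnorm_ge0.
    - by rewrite lee_fin sqr_ge0.
  apply: (@le_trans _ _ ((eps^-1 ^+ 2)%:E * ((c * eps) ^+ 2)%:E)%E).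
    by rewrite lee_wpmul2l// lee_fin sqr_ge0.
  by rewrite -EFinM lee_fin -exprMn mulrCA mulVf ?mulr1// gt_eqF.
have idc := cutoff_id hchi0 htheta theta'_le uU'.
apply/funext => x; rewrite /cutoff_eps idc ?scalerA ?mulfV ?scale1r// ?gt_eqF// => y.
by apply: le_lt_trans (wjet_small htheta theta'_le y uU' ue) _; rewrite lte_fin.
Qed.

End scaled_cutoff.

Theorem corollary1p3 (R : realType) (n : nat) (hn : (1 <= n)%N)
    (chi0 theta : R -> R)
    (hchi0 : smooth_indicator chi0) (htheta : partition_generator theta)
    (eta : R) (heta : 0 < eta) :
  exists C0 C1 CL : R, [/\ 0 < C0, 0 < C1, 0 < CL &
    forall eps : R, 0 < eps ->
    [/\ (* (i) *)
        (forall u : R -> 'rV[R]_n, H1w eta u ->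
           cutoff_defined chi0 theta (fun z => eps^-1 *: u z) /\
           H1w eta (cutoff_eps chi0 theta eps u)) /\
        (forall u v : R -> 'rV[R]_n, H1w eta u -> H1w eta v ->
           u = v %[ae (@lebesgue_measure R)] ->
           cutoff_eps chi0 theta eps u = cutoff_eps chi0 theta eps v
             %[ae (@lebesgue_measure R)]),
        (* (ii) *)
        (forall (y : R) (u : R -> 'rV[R]_n), H1w eta u ->
           H1w eta (translate y u) /\
           cutoff_eps chi0 theta eps (translate y u) =
             translate y (cutoff_eps chi0 theta eps u)
             %[ae (@lebesgue_measure R)]),
        (* (iii) *)
        (forall u : R -> 'rV[R]_n, H1u u -> (normH1u u < (C0 * eps)%:E)%E ->
           cutoff_eps chi0 theta eps u = u %[ae (@lebesgue_measure R)]),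
        (* (iv) *)
        (forall u : R -> 'rV[R]_n, H1w eta u ->
           H1u (cutoff_eps chi0 theta eps u) /\
           (normH1u (cutoff_eps chi0 theta eps u) < (C1 * eps)%:E)%E)
      & (* (v) *)
        (forall u v : R -> 'rV[R]_n, H1w eta u -> H1w eta v ->
           (normH1w eta (fun x => cutoff_eps chi0 theta eps u x
                                  - cutoff_eps chi0 theta eps v x)%R
            <= CL%:E * normH1w eta (fun x => u x - v x)%R)%E)]].
Proof.
have [_ [K [K0 theta'_le _]]] :=
  test_function_bounded (test_function_derive1 (theta_test htheta)).
pose M := 2 * K ^+ 2 + 3; have M3 : 3 <= M by have := sqr_ge0 K; rewrite /M; lra.
have M0 : 0 < M by lra.
(* With [c = (3 * M)^-1] one has [M * (3 * c ^+ 2) = c < 1]. The value 30 exceeds the root of 875,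
   which makes the bound in (iv) strict. *)
exists (3 * M)^-1, 30, (Num.sqrt (lipschitz_sq K eta)).
have C00 : 0 < (3 * M)^-1 by rewrite invr_gt0; lra.
have small : M * ((3 * M)^-1 ^+ 2 + (3 * M)^-1 ^+ 2 + (3 * M)^-1 ^+ 2) < 1.
  rewrite (_ : _ * _ = (3 * M)^-1); last by field; rewrite gt_eqF.
  by rewrite invf_lt1; lra.
split; [exact: C00|by rewrite ltr0n|by rewrite sqrtr_gt0; exact: lipschitz_sq_gt0|].
move=> eps eps0; split.
- split=> [u [/H1loc_jet uU fu]|u v [/H1loc_jet uU _] [[lv _] _] uv].
    have uU' := jetZ eps^-1 uU; split; last split.
    + split=> [y|x i]; first exact: (H1_window htheta theta'_le uU').
      exact: (cutoff_integrable hchi0 htheta theta'_le x i uU').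
    + exact: jet_H1loc (cutoff_eps_jet hchi0 htheta theta'_le eps uU).
    + exact: (cutoff_eps_H1w hchi0 htheta theta'_le heta eps0 uU fu).
  (* Independence of the chosen representative, as required for a map between spaces of classes. *)
  have lv' : L2loc (fun x => eps^-1 *: v x).
    by apply: (L2loc_bounded (M := `|eps^-1|)) => //; exact: measurable_cst.
  have uv' : {ae @lebesgue_measure R, forall x, eps^-1 *: u x = eps^-1 *: v x}.
    by apply: ae_sub uv => x /(_ I) ->.
  have := cutoff_ae chi0 htheta (jetZ eps^-1 uU) lv' uv'.
  by apply: ae_sub => x + _; rewrite /cutoff_eps => ->.
- move=> y u [/H1loc_jet uU fu]; split; first split.
  + exact: jet_H1loc (jet_translate y uU).
  + exact: (normH1w_translate htheta heta y uU fu).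
  + rewrite (cutoff_eps_translate hchi0 htheta theta'_le y eps uU).
    exact: ae_eq_refl.
- move=> u [/H1loc_jet uU _] uc.
  rewrite (cutoff_eps_id hchi0 htheta theta'_le eps0 uU C00 small uc).
  exact: ae_eq_refl.
- move=> u [/H1loc_jet uU _].
  have b := cutoff_eps_H1u hchi0 htheta theta'_le eps0 uU.
  split; first split.
  + exact: jet_H1loc (cutoff_eps_jet hchi0 htheta theta'_le eps uU).
  + by apply: le_lt_trans b _; rewrite ltry.
  + apply: le_lt_trans b _; rewrite lte_fin ltr_pM2r//.
    rewrite -(@ltr_sqr _ _ 30) ?nnegrE ?sqrtr_ge0//.
    by rewrite sqr_sqrtr ?expr2; lra.
- move=> u v [/H1loc_jet uU _] [/H1loc_jet vV _].
  exact: (cutoff_eps_lipschitz hchi0 htheta theta'_le heta eps0 uU vV).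
Qed.
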